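(* Let $\mathbf A$ be a basic non-hereditary nodal algebra over an algebraically closed field $\mathbbm k$. Then $\mathbf A$ is skewed-gentle if and only if it is obtained from a direct product of hereditary algebras of type $\mathrm A$ or $\widetilde{\mathrm A}$ by a suitable sequence of gluings and blowings up defined by a sequence of vertices such that, for each of these vertices, there is at most one arrow starting and at most one arrow ending at it. Moreover, $\mathbf A$ is gentle if and only if, in addition, it is obtained in this way using only gluings.
   Context: All algebras are finite-dimensional over $\mathbbm k$; a basic algebra is given by a quiver with relations; $\alpha\beta$ denotes the path ''first $\beta$, then $\alpha$''. Hereditary basic algebras are path algebras of quivers without oriented cycles; type $\mathrm A$ / $\widetilde{\mathrm A}$ means the quiver is of Dynkin type $\mathrm A_n$ / Euclidean type $\widetilde{\mathrm A}_n$. A nodal algebra is an algebra $\mathbf A$ for which there is a hereditary algebra $\mathbf H$ with $\operatorname{rad}\mathbf H\subset\mathbf A\subseteq\mathbf H$, $\operatorname{rad}\mathbf A=\operatorname{rad}\mathbf H$ and $\operatorname{length}_{\mathbf A}(\mathbf H\otimes_{\mathbf A}U)\le 2$ for every simple $\mathbf A$-module $U$. Basic nodal algebras are exactly those obtained from basic hereditary algebras by suitable sequences of gluings and blowings up, described on quivers as follows. Gluing distinct vertices $i,j$: identify them into one vertex, keep all arrows, and add all relations $\alpha\beta$ with $\alpha$ starting at $i$ and $\beta$ ending at $j$, or $\alpha$ starting at $j$ and $\beta$ ending at $i$. Blowing up a vertex $i$ (without loops): replace $i$ by $i',i''$, each arrow $\alpha:k\to i$ by $\alpha':k\to i'$,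 $\alpha'':k\to i''$, each arrow $\beta:i\to k$ by $\beta':i'\to k$, $\beta'':i''\to k$, replace each relation involving arrows at $i$ by its two copies $'$ and $''$, and for each $\beta$ starting and $\alpha$ ending at $i$ add $\beta'\alpha'=\beta''\alpha''$. A suitable sequence is given by pairwise distinct vertices $i_1,\dots,i_{r+s},j_1,\dots,j_r$ of the original quiver: glue $i_k$ with $j_k$ ($k\le r$), blow up $i_k$ ($r<k\le r+s$). A basic algebra with quiver $\Gamma$ and relations $R$ is gentle if: at most two arrows start and at most two end at each vertex; all relations are of the form $\alpha\beta$ for arrows $\alpha,\beta$; if $\alpha_1,\alpha_2$ start at $i$ then for each $\beta$ ending at $i$ exactly one of $\alpha_1\beta,\alpha_2\beta$ is in $R$; if $\beta_1,\beta_2$ end at $i$ then for each $\alpha$ starting at $i$ exactly one of $\alpha\beta_1,\alpha\beta_2$ is in $R$. It is skewed-gentle if it is obtained from a gentle algebra by blowing up some vertices $i$ at which at most one arrow $\alpha$ starts, at most one arrow $\beta$ ends, and, if both exist, $\alpha\beta\notin R$. *)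

(* Defs.v *)
From HB Require Import structures.
From mathcomp Require Import all_boot all_order all_algebra all_field.
Set Implicit Arguments. Unset Strict Implicit. Unset Printing Implicit Defensive.
Import GRing.Theory.
Local Open Scope ring_scope.

(* Quivers with relations (presentations of basic algebras).                 *)
(* Vertices are 0 .. nv-1, arrows are 0 .. size arrs - 1; arrow k goes from  *)
(* (nth _ arrs k).1 (source) to (nth _ arrs k).2 (target).                    *)
(* A relation is a formal linear combination of paths; a path [:: a1; ..; an]*)
(* is written in composition order: "a1 a2" = first a2, then a1.             *)

Record pres (K : Type) := Pres {
  nv : nat;
  arrs : seq (nat * nat);
  rels : seq (seq (K * seq nat)) }.

Section Pres.
Variable K : fieldType.
Implicit Types P : pres K.

Definition narr P := size (arrs P).
Definition src P (a : nat) := (nth (0%N, 0%N) (arrs P) a).1.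
Definition tgt P (a : nat) := (nth (0%N, 0%N) (arrs P) a).2.
Definition arrows P := iota 0 (narr P).

Definition zrel (a b : nat) : seq (K * seq nat) := [:: (1, [:: a; b])].
Definition inR P (a b : nat) : bool := zrel a b \in rels P.

Definition outdeg P v := count (fun a => src P a == v) (arrows P).
Definition indeg P v := count (fun a => tgt P a == v) (arrows P).

Definition wf_pres P :=
  (forall a, (a < narr P)%N -> (src P a < nv P)%N /\ (tgt P a < nv P)%N) /\
  (forall rho cp a, rho \in rels P -> cp \in rho -> a \in cp.2 -> (a < narr P)%N).

Inductive reach P : nat -> nat -> Prop :=
| reach_refl v : reach P v v
| reach_step a w : (a < narr P)%N -> reach P (tgt P a) w -> reach P (src P a) w.

Definition acyclic P := forall a, (a < narr P)%N -> ~ reach P (tgt P a) (src P a).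

Definition hereditary_pres P := wf_pres P /\ rels P = [::] /\ acyclic P.

Definition gren (i j : nat) (v : nat) : nat :=
  let w := if v == j then i else v in if (j < w)%N then w.-1 else w.

Definition glue P (i j : nat) : pres K :=
  Pres (nv P).-1
       [seq (gren i j p.1, gren i j p.2) | p <- arrs P]
       (rels P ++
        [seq zrel ab.1 ab.2 | ab <- [seq (a, b) | a <- arrows P, b <- arrows P] &
           ((src P ab.1 == i) && (tgt P ab.2 == j)) ||
           ((src P ab.1 == j) && (tgt P ab.2 == i))]).

(* blowup i: i' := i (same number), i'' := nv (new vertex).  Each arrow a at  *)
(* i keeps its number as a', and its copy a'' gets number narr + (position of *)
(* a among the arrows at i).  Relations involving arrows at i are replaced by *)
(* their two copies; relations b' a' = b'' a'' are added (as b'a' - b''a''). *)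
Definition atv P (i a : nat) : bool := (src P a == i) || (tgt P a == i).
Definition arrs_at P i := [seq a <- arrows P | atv P i a].
Definition dbl P i (a : nat) : nat := (narr P + index a (arrs_at P i))%N.

Definition blowup P (i : nat) : pres K :=
  let n := nv P in
  let sw v := if v == i then n else v in
  let cpy a := if atv P i a then dbl P i a else a in
  Pres n.+1
    (arrs P ++ [seq (sw (src P a), sw (tgt P a)) | a <- arrs_at P i])
    (flatten [seq (if has (fun cp : K * seq nat => has (atv P i) cp.2) rho
                   then [:: rho; [seq (cp.1, map cpy cp.2) | cp <- rho]]
                   else [:: rho]) | rho <- rels P]
     ++ [seq [:: (1, [:: ba.1; ba.2]); (-1, [:: dbl P i ba.1; dbl P i ba.2])]
          | ba <- [seq (b, a) | b <- arrows P, a <- arrows P] &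
            (src P ba.1 == i) && (tgt P ba.2 == i)]).

(* gl = [:: (i_1, j_1); ..; (i_r, j_r)]  (gluings),  bl = [:: i_{r+1}; ..]   *)
(* (blowings up), all vertices of the ORIGINAL quiver; gluings are done     *)
(* first, in order, then the blowings up; references are renumbered along.  *)
(* [r] renames vertices of the original quiver into the current one *)
Fixpoint glue_all P (gl : seq (nat * nat)) (r : nat -> nat) : pres K * (nat -> nat) :=
  match gl with
  | [::] => (P, r)
  | (i, j) :: gl' => glue_all (glue P (r i) (r j)) gl' (gren (r i) (r j) \o r)
  end.

Fixpoint blow_all P (bl : seq nat) : pres K :=
  match bl with
  | [::] => P
  | i :: bl' => blow_all (blowup P i) bl'
  end.

Definition apply_seq P gl bl : pres K :=
  let: (P', r) := glue_all P gl id in blow_all P' (map r bl).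

Definition seq_vertices (gl : seq (nat * nat)) (bl : seq nat) : seq nat :=
  flatten [seq [:: p.1; p.2] | p <- gl] ++ bl.

Definition suitable P gl bl :=
  uniq (seq_vertices gl bl) /\ all (fun v => (v < nv P)%N) (seq_vertices gl bl).

(* the underlying (multi)graph is a disjoint union of paths (type A_n) and   *)
(* cycles (type A~_n, n >= 1, A~_1 being the double edge): [blocks] lists   *)
(* the vertices of each component in order, [cyc] says which are cycles.   *)
Definition upair (u v : nat) : nat * nat := (minn u v, maxn u v).

Definition block_edges (b : seq nat) (c : bool) : seq (nat * nat) :=
  [seq upair (nth 0%N b k) (nth 0%N b k.+1) | k <- iota 0 (size b).-1] ++
  (if c && (1 < size b)%N then [:: upair (last 0%N b) (head 0%N b)] else [::]).

Definition typeA_Atilde P :=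
  exists (blocks : seq (seq nat)) (cyc : seq bool),
    size cyc = size blocks /\
    all (fun b => b != [::]) blocks /\
    perm_eq (flatten blocks) (iota 0 (nv P)) /\
    (forall k, (k < size blocks)%N -> nth false cyc k ->
        (1 < size (nth [::] blocks k))%N) /\
    perm_eq [seq upair (src P a) (tgt P a) | a <- arrows P]
            (flatten [seq block_edges bc.1 bc.2 | bc <- zip blocks cyc]).

Definition gentle_pres P :=
  wf_pres P /\
  (forall v, (outdeg P v <= 2)%N /\ (indeg P v <= 2)%N) /\
  (forall rho, rho \in rels P -> exists a b, rho = zrel a b) /\
  (forall a1 a2 b, (a1 < narr P)%N -> (a2 < narr P)%N -> (b < narr P)%N ->
      a1 != a2 -> src P a1 = src P a2 -> tgt P b = src P a1 ->
      inR P a1 b (+) inR P a2 b) /\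
  (forall b1 b2 a, (b1 < narr P)%N -> (b2 < narr P)%N -> (a < narr P)%N ->
      b1 != b2 -> tgt P b1 = tgt P b2 -> src P a = tgt P b1 ->
      inR P a b1 (+) inR P a b2).

(* vertices of a gentle presentation that may be blown up *)
Definition sg_vertex P (i : nat) :=
  (i < nv P)%N /\ (outdeg P i <= 1)%N /\ (indeg P i <= 1)%N /\
  (forall a, (a < narr P)%N -> src P a = i -> tgt P a <> i) /\
  (forall a b, (a < narr P)%N -> (b < narr P)%N ->
      src P a = i -> tgt P b = i -> ~~ inR P a b).

Definition evalrel (A : falgType K) (x : nat -> A) (rho : seq (K * seq nat)) : A :=
  \sum_(cp <- rho) cp.1 *: \prod_(a <- cp.2) x a.

Definition satisfies P (B : falgType K) (e x : nat -> B) :=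
  (forall v w, (v < nv P)%N -> (w < nv P)%N ->
      e v * e w = (if v == w then e v else 0)) /\
  \sum_(v < nv P) e v = 1 /\
  (forall a, (a < narr P)%N -> x a = e (tgt P a) * x a * e (src P a)) /\
  (forall rho, rho \in rels P -> evalrel x rho = 0).

(* A is (isomorphic to) k Q / (R): A is generated by elements satisfying the  *)
(* relations, universally among finite-dimensional K-algebras.              *)
Definition presents (A : falgType K) P :=
  exists e x : nat -> A,
    satisfies P e x /\
    agenv <<[seq e v | v <- iota 0 (nv P)] ++ [seq x a | a <- arrows P]>>%VS
      = fullv /\
    (forall (B : falgType K) (e' x' : nat -> B), satisfies P e' x' ->
       exists f : 'AHom(A, B),
         (forall v, (v < nv P)%N -> f (e v) = e' v) /\
         (forall a, (a < narr P)%N -> f (x a) = x' a)).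

Definition hereditary_alg (A : falgType K) :=
  exists P, hereditary_pres P /\ presents A P.

Definition nodal_basic (A : falgType K) :=
  exists P gl bl, hereditary_pres P /\ suitable P gl bl /\ presents A (apply_seq P gl bl).

Definition gentle_alg (A : falgType K) :=
  exists P, gentle_pres P /\ presents A P.

Definition skewed_gentle_alg (A : falgType K) :=
  exists P bl, gentle_pres P /\ uniq bl /\ (forall i, i \in bl -> sg_vertex P i) /\
    presents A (blow_all P bl).

End Pres.

(* Main.v *)
(** A gentle presentation is unglued at every vertex carrying a relation: the
   gentle axioms split the arrows at such a vertex into two halves, each with at
   most one incoming and one outgoing arrow, so that a product across the vertex
   is a relation exactly when it joins different halves.  The unglued quiver has
   no relations and all its vertices have degree at most 2, so it is a disjoint
   union of paths and cycles, and gluing back recovers the gentle algebra.  An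
   oriented cycle of the unglued quiver would be a relation-free cycle of the
   gentle one; following it for N steps gives a representation of the gentle
   algebra, and of its blow-ups, which forces their dimension to exceed N.
   Conversely, gluing vertices of in- and outdegree at most 1 of a quiver of type
   A or A~ creates exactly the relations required by the gentle axioms.  Vertices
   that may be blown up are not affected by the gluings, in either direction. *)
Require Import Defs.
From HB Require Import structures.
From mathcomp Require Import all_boot all_order all_algebra all_field.
From mathcomp Require Import zify.
Set Implicit Arguments. Unset Strict Implicit. Unset Printing Implicit Defensive.
Import GRing.Theory.
Local Open Scope ring_scope.

(** * Multigraphs of maximal degree two as disjoint unions of paths and cycles *)

Section PathsAndCycles.
Local Open Scope nat_scope.
Implicit Types (v w x y : nat) (b s t V : seq nat) (E : seq (nat * nat)).
Implicit Types D : seq (seq nat * bool).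

Definition edge_deg E v :=
  count (fun p => p.1 == v) E + count (fun p => p.2 == v) E.

Lemma edge_deg_cons p E v :
  edge_deg (p :: E) v = (p.1 == v) + (p.2 == v) + edge_deg E v.
Proof. by rewrite /edge_deg /=; lia. Qed.

Lemma edge_deg_cat E1 E2 v : edge_deg (E1 ++ E2) v = edge_deg E1 v + edge_deg E2 v.
Proof. by rewrite /edge_deg !count_cat; lia. Qed.

Lemma edge_deg_perm E1 E2 v : perm_eq E1 E2 -> edge_deg E1 v = edge_deg E2 v.
Proof. by move=> /permP h; rewrite /edge_deg !h. Qed.

Lemma edge_deg_upair_cons x y E v :
  edge_deg (upair x y :: E) v = (x == v) + (y == v) + edge_deg E v.
Proof. by rewrite edge_deg_cons /upair /=; case: (leqP x y) => h; lia. Qed.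

Lemma edge_deg_upair E v : edge_deg [seq upair p.1 p.2 | p <- E] v = edge_deg E v.
Proof.
elim: E => //= p E IH; by rewrite edge_deg_upair_cons IH edge_deg_cons.
Qed.

Lemma upairC x y : upair x y = upair y x.
Proof. by rewrite /upair minnC maxnC. Qed.

(** The path part of [block_edges], by recursion on the list, so that concatenation and reversal of
    paths can be treated by induction. *)
Fixpoint chain b : seq (nat * nat) :=
  if b is x :: b' then (if b' is y :: _ then upair x y :: chain b' else [::])
  else [::].

Lemma block_edgesE b c : block_edges b c = chain b ++
  (if c && (1 < size b) then [:: upair (last 0 b) (head 0 b)] else [::]).
Proof.
congr cat; elim: b => [//|x [//|y b] IH].
rewrite -[RHS]/(upair x y :: chain (y :: b)) -IH /= (iotaDl 1 0) -map_comp.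
by [].
Qed.

Lemma chain_cat x s y t :
  chain ((x :: s) ++ y :: t) = chain (x :: s) ++ upair (last x s) y :: chain (y :: t).
Proof. by elim: s x => [//|z s IH] x; rewrite /= -IH. Qed.

Lemma chain_rev b : perm_eq (chain (rev b)) (chain b).
Proof.
elim: b => [//|x [//|y b] IH].
rewrite rev_cons -cats1.
have := IH; have : last 0 (rev (y :: b)) = y by rewrite rev_cons last_rcons.
have : size (rev (y :: b)) = (size b).+1 by rewrite size_rev.
case: (rev (y :: b)) => [//|z s] _.
move=> hl hp; rewrite /= in hl; rewrite chain_cat hl cats1 perm_rcons upairC.
by rewrite perm_cons.
Qed.

Lemma edge_deg_chain x s v :
  edge_deg (chain (x :: s)) v = count_mem v (belast x s) + count_mem v s.
Proof.
elim: s x => [//|y s IH] x.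
rewrite -[chain _]/(upair x y :: chain (y :: s)) edge_deg_upair_cons IH /=; lia.
Qed.

Lemma edge_deg_block b c v : edge_deg (block_edges b c) v <= 2 * count_mem v b.
Proof.
case: b => [|x s]; first by case: c.
rewrite block_edgesE edge_deg_cat edge_deg_chain.
(* The block is split once before its last entry and once after its head; the two end terms pay for
   the closing edge of a cycle. *)
have -> : 2 * count_mem v (x :: s) =
    (count_mem v (belast x s) + (last x s == v)) + ((x == v) + count_mem v s).
  by rewrite {1}mul2n -addnn {1}lastI -cats1 count_cat /= addn0.
case: ifP => _; last by rewrite /edge_deg /=; lia.
by rewrite edge_deg_upair_cons /edge_deg /=; lia.
Qed.

(** An inner vertex of a path already meets two edges, and in a cycle the closing edge raises both
    ends to degree two; only the ends of a path are left. *)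
Lemma block_low_deg b (c : bool) v : uniq b -> (c -> 1 < size b) -> v \in b ->
  edge_deg (block_edges b c) v <= 1 -> c = false /\ (v = head 0 b \/ v = last 0 b).
Proof.
case: b => [//|x s] ub hc vb; rewrite block_edgesE edge_deg_cat edge_deg_chain.
have e1 : count_mem v (x :: s) = 1 by rewrite count_uniq_mem // vb.
have e2 : count_mem v (x :: s) = count_mem v (belast x s) + (last x s == v).
  by rewrite {1}lastI -cats1 count_cat /= addn0.
have e3 : count_mem v (x :: s) = (x == v) + count_mem v s by [].
case: c hc => hc; last first.
  rewrite /= => h; split=> //.
  have [<-|nx] := eqVneq x v; [by left | right].
  by move: e1 e2 e3 h; rewrite /= (negPf nx) /edge_deg /=; lia.
rewrite hc // [true && _]/= edge_deg_upair_cons /edge_deg /=.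
by move: e1 e2 e3; rewrite /=; lia.
Qed.

(** The content of [typeA_Atilde] for arbitrary vertex and edge lists, with every block paired with
    its cycle flag, so that edges can be added one at a time. *)
Definition decomposition V E D :=
  [/\ all (fun bc => (bc.1 != [::]) && (bc.2 ==> (1 < size bc.1))) D,
      perm_eq (flatten (map fst D)) V &
      perm_eq E (flatten [seq block_edges bc.1 bc.2 | bc <- D])].

Lemma decomposition_perm V E D1 D2 :
  perm_eq D1 D2 -> decomposition V E D1 -> decomposition V E D2.
Proof.
move=> p [h1 h2 h3]; split; first by rewrite -(perm_all _ p).
  by apply: perm_trans h2; apply: perm_flatten; apply: perm_map; rewrite perm_sym.
by apply: perm_trans h3 _; apply: perm_flatten; apply: perm_map.
Qed.

(** By [block_low_deg] such a vertex is an end of a path block. If it is the last entry, the block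
    is reversed, which only permutes its edges. *)
Lemma decomposition_first V E D v : uniq V -> v \in V -> edge_deg E v <= 1 ->
  decomposition V E D ->
  exists s D', decomposition V E ((v :: s, false) :: D').
Proof.
move=> uV vV dv dD; have [h1 h2 h3] := dD.
have : v \in flatten (map fst D) by rewrite (perm_mem h2).
case/flatten_mapP=> -[b c] bD vb.
have pD := perm_to_rem bD; move: (rem _ _) pD => D' pD.
have {dD} := decomposition_perm pD dD; move=> -[/= /andP[/andP[nb cb] h1'] h2' h3'].
have ub : uniq b by move: uV; rewrite -(perm_uniq h2') cat_uniq => /andP[].
have db : edge_deg (block_edges b c) v <= 1.
  by move: dv; rewrite (edge_deg_perm _ h3') edge_deg_cat; lia.
have [c0 [hd|hl]] := block_low_deg ub (implyP cb) vb db; rewrite {}c0 in h3' *.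
  case: b hd nb vb cb h2' h3' {ub db bD pD} => //= x s -> _ _ _ h2' h3'.
  by exists s, D'; split.
case/lastP: b hl nb vb cb h2' h3' {ub db bD pD} => // s x.
rewrite last_rcons => <- _ _ _ h2' h3'.
exists (rev s), D'; split=> //.
  apply: perm_trans h2'; rewrite /= -cat_cons perm_cat2r.
  by rewrite perm_sym perm_rcons perm_cons perm_sym perm_rev.
apply: perm_trans h3' _; rewrite [in X in perm_eq _ X]/= !block_edgesE !cats0 perm_cat2r.
by rewrite perm_sym -(rev_rcons s v) chain_rev.
Qed.

(** Induction on the edges. Before an edge between [u] and [v] is inserted, both have degree at most
    one, so each is an end of a path. The new edge closes a path to a cycle if both lie on the same
    one, and joins two paths otherwise. *)
Lemma decomposition_exists V E : uniq V ->
  (forall p, p \in E -> [/\ p.1 != p.2, p.1 \in V & p.2 \in V]) ->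
  (forall v, edge_deg E v <= 2) ->
  exists D, decomposition V [seq upair p.1 p.2 | p <- E] D.
Proof.
move=> uV; elim: E => [|[u v] E IH] hE dE.
  (* Without edges every vertex is a path of its own. *)
  exists [seq ([:: v], false) | v <- V]; split.
  - by rewrite all_map; apply/allP.
  - by rewrite -map_comp (eq_map (g := fun x => [:: x])) // flatten_map1 map_id.
  - by rewrite -map_comp; elim: {uV hE} V => //= x V; rewrite block_edgesE.
have [|w|D dD] := IH; first by move=> p pE; apply: hE; rewrite inE pE orbT.
  by apply: leq_trans (dE w); rewrite edge_deg_cons leq_addl.
have /= [uv uV' vV] := hE (u, v) (mem_head _ _).
set E' := map _ E in dD *.
have du : edge_deg E' u <= 1.
  by have := dE u; rewrite edge_deg_upair edge_deg_cons eqxx; lia.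
have dv : edge_deg E' v <= 1.
  by have := dE v; rewrite edge_deg_upair edge_deg_cons /= eqxx; lia.
have [s [D' dD']] := decomposition_first uV uV' du dD.
have [h1 h2 h3] := dD'.
have ub : uniq ((u :: s) ++ flatten (map fst D')) by rewrite (perm_uniq h2).
have := vV; rewrite -(perm_mem h2) mem_cat => /orP[vs|vD'].
  have db : edge_deg (block_edges (u :: s) false) v <= 1.
    by apply: leq_trans dv; rewrite (edge_deg_perm _ h3) [X in _ <= X]edge_deg_cat leq_addr.
  have us : uniq (u :: s) by move: ub; rewrite cat_uniq => /andP[].
  have [_ [vu|]] := block_low_deg us (c := false) (fun e => False_ind _ (elimF idP erefl e)) vs db.
    by rewrite /= in vu; rewrite vu eqxx in uv.
  move=> /= vl.
  (* As [u] and [v] differ, the path to be closed has at least two vertices; with exactly two it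
     becomes the double edge. *)
  have s1 : 0 < size s by case: s vl {vs us ub db h1 h2 h3 dD'} uv => //= ->; rewrite eqxx.
  exists ((u :: s, true) :: D'); split=> //.
    by move: h1; rewrite /= ltnS s1.
  rewrite /= block_edgesE /= ltnS s1 -vl upairC -catA.
  rewrite perm_sym perm_catC /= perm_cons perm_catC perm_sym.
  by move: h3; rewrite /= block_edgesE /= cats0.
have uD' : uniq (flatten (map fst D')) by move: ub; rewrite cat_uniq => /and3P[].
set E2 := flatten [seq block_edges bc.1 bc.2 | bc <- D'].
have dD2 : decomposition (flatten (map fst D')) E2 D' by [].
have dv2 : edge_deg E2 v <= 1.
  by apply: leq_trans dv; rewrite (edge_deg_perm _ h3) [X in _ <= X]edge_deg_cat leq_addl.
have [s' [D'' [g1 g2 g3]]] := decomposition_first uD' vD' dv2 dD2.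
(* The path of [u] is reversed so that it ends in [u], and the new edge links it to the start of the
   path of [v]. *)
exists ((rev s ++ u :: v :: s', false) :: D''); split.
- by move: g1 => /= ->; rewrite andbT; case: (rev s).
- apply: perm_trans h2; rewrite /= -cat1s catA -catA -cat_cons.
  rewrite -cat_rcons -catA -cats1 -catA perm_catCA /= perm_cons.
  by apply: perm_cat; [rewrite perm_rev|].
- rewrite /= !block_edgesE /= cats0.
  have -> : rev s ++ u :: v :: s' = rev (u :: s) ++ v :: s'.
    by rewrite rev_cons cat_rcons.
  case er : (rev (u :: s)) => [|z r]; first by have := congr1 size er; rewrite size_rev.
  have hl : last z r = u by rewrite -[LHS]/(last 0 (z :: r)) -er rev_cons last_rcons.
  rewrite chain_cat hl -er -/(u :: s) -catA.
  rewrite perm_sym perm_catC /= perm_cons perm_sym.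
  apply: perm_trans h3 _; rewrite /= block_edgesE /= cats0 perm_catC.
  apply: perm_cat; last by rewrite perm_sym chain_rev.
  by apply: perm_trans g3 _; rewrite /= block_edgesE /= cats0.
Qed.

End PathsAndCycles.

(** * Degree criterion for the types A and A~ *)

Section TypeA.
Variable K : fieldType.
Implicit Types P : pres K.
Local Open Scope nat_scope.

Lemma mem_arrows P a : (a \in arrows P) = (a < narr P).
Proof. by rewrite /arrows mem_iota. Qed.

Lemma edge_deg_arrs P v :
  edge_deg [seq upair (src P a) (tgt P a) | a <- arrows P] v = outdeg P v + indeg P v.
Proof.
have -> : [seq upair (src P a) (tgt P a) | a <- arrows P] =
   [seq upair p.1 p.2 | p <- [seq (src P a, tgt P a) | a <- arrows P]].
  by rewrite -map_comp.
by rewrite edge_deg_upair /edge_deg !count_map.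
Qed.

(** Each block contributes at most two edge ends per occurrence of [v], and [v] occurs at most once
    in all blocks together. *)
Lemma typeA_deg P v : typeA_Atilde P -> outdeg P v + indeg P v <= 2.
Proof.
move=> [bs [cs [hs [_ [pV [_ pE]]]]]]; rewrite -edge_deg_arrs (edge_deg_perm _ pE).
have le2 : 2 * count_mem v (flatten bs) <= 2.
  rewrite (permP pV) count_uniq_mem ?iota_uniq //; by case: (_ \in _).
apply: leq_trans le2; elim: bs cs hs {pV pE} => [|b bs IH] [|c cs] //= [hs].
rewrite edge_deg_cat count_cat mulnDr; apply: leq_add; last exact: IH.
exact: edge_deg_block.
Qed.

(** Loops have to be excluded because a cycle block has at least two vertices; the rest is
    [decomposition_exists]. *)
Lemma typeA_of_deg P : wf_pres P ->
  (forall a, a < narr P -> src P a <> tgt P a) ->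
  (forall v, outdeg P v + indeg P v <= 2) -> typeA_Atilde P.
Proof.
move=> [wfP _] nl dP.
pose E := [seq (src P a, tgt P a) | a <- arrows P].
have [||D [h1 h2 h3]] := @decomposition_exists (iota 0 (nv P)) E (iota_uniq _ _).
- move=> p /mapP[a]; rewrite mem_arrows => ha ->.
  by have [s t] := wfP a ha; rewrite !mem_iota /= s t; split=> //; apply/eqP/nl.
- by move=> v; rewrite -edge_deg_upair -map_comp edge_deg_arrs.
exists (map fst D), (map snd D); split; first by rewrite !size_map.
split; first by rewrite all_map; apply: sub_all h1 => bc /andP[].
split=> //; split.
  move=> k; rewrite size_map => kD.
  rewrite !(nth_map ([::], false)) // => hc.
  have /andP[_] := allP h1 _ (mem_nth ([::], false) kD).
  by rewrite hc.
by rewrite zip_map -map_comp; move: h3; rewrite -map_comp.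
Qed.

End TypeA.

(** * Sequences of gluings of a quiver without relations *)

Section Gluing.
Variable K : fieldType.
Implicit Types (P Q : pres K) (gl : seq (nat * nat)).
Local Open Scope nat_scope.

Definition glued gl (u v : nat) := ((u, v) \in gl) || ((v, u) \in gl).

Definition gl_vertices gl : seq nat := flatten [seq [:: p.1; p.2] | p <- gl].

Lemma gl_vertices_cat gl1 gl2 :
  gl_vertices (gl1 ++ gl2) = gl_vertices gl1 ++ gl_vertices gl2.
Proof. by rewrite /gl_vertices map_cat flatten_cat. Qed.

Lemma glued_sym gl u v : glued gl u v = glued gl v u.
Proof. exact: orbC. Qed.

Lemma glued_mem gl u v : glued gl u v -> u \in gl_vertices gl.
Proof. by case/orP=> h; apply/flatten_mapP; eexists; try exact: h; rewrite !inE eqxx ?orbT. Qed.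

Lemma glued_exists gl u : u \in gl_vertices gl -> exists v, glued gl u v.
Proof.
case/flatten_mapP=> -[i j] h; rewrite !inE /= => /orP[]/eqP->.
  by exists j; rewrite /glued h.
by exists i; rewrite /glued h orbT.
Qed.

Lemma glued_rcons gl i j u v : glued (rcons gl (i, j)) u v =
  [|| glued gl u v, (u == i) && (v == j) | (u == j) && (v == i)].
Proof.
rewrite /glued !mem_rcons !inE !xpair_eqE.
by do 2!case: (_ \in gl); case: (u == i); case: (u == j); case: (v == i); case: (v == j).
Qed.

(** The entries of all pairs are distinct, so passing to the partner is a partial involution without
    fixed points. *)
Lemma glued_unique gl u v w : uniq (gl_vertices gl) -> glued gl u v -> glued gl u w ->
  u != v /\ v = w.
Proof.
elim: gl => [//|[i j] gl IH] /=; rewrite inE negb_or -andbA.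
case/and4P=> ij ni nj ugl.
have hi x : glued gl i x = false by apply: contraNF ni; apply: glued_mem.
have hj x : glued gl j x = false by apply: contraNF nj; apply: glued_mem.
have hc x y : glued ((i, j) :: gl) x y =
    [|| glued gl x y, (x == i) && (y == j) | (x == j) && (y == i)].
  rewrite -glued_rcons /glued !inE !mem_rcons !inE; by [].
rewrite !hc.
have [->|ui] := eqVneq u i.
  rewrite !hi (negPf ij) /= !orbF => /eqP-> /eqP->; by rewrite ij.
have [->|uj] := eqVneq u j; last by rewrite /= !orbF; apply: IH.
by rewrite !hj /= => /eqP-> /eqP->; rewrite eq_sym ij.
Qed.

Lemma gren_lt n i j v : i < n -> j < n -> i != j -> v < n -> gren i j v < n.-1.
Proof. by rewrite /gren => ? ? /eqP ? ?; case: (v =P j) => ? /=; case: ifP; lia. Qed.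

Lemma gren_eq i j u v : i != j -> (gren i j u == gren i j v) =
  [|| u == v, (u == i) && (v == j) | (u == j) && (v == i)].
Proof.
rewrite /gren => /eqP ij.
by case: (u =P j) => ?; case: (v =P j) => ? /=; repeat case: ifP; lia.
Qed.

(** Invariant of a sequence of gluings, expressed through the original quiver. Arrows keep their
    numbers under gluing, so relations can be described by original sources and targets, however
    often the vertices have been renumbered. *)
Record glue_state (P0 : pres K) gl P (r : nat -> nat) : Prop := GlueState {
  glue_nv : nv P + size gl = nv P0;
  glue_arrs : arrs P = [seq (r p.1, r p.2) | p <- arrs P0];
  glue_lt : forall u, u < nv P0 -> r u < nv P;
  glue_eq : forall u v, u < nv P0 -> v < nv P0 -> (r u == r v) = (u == v) || glued gl u v;
  glue_rels : forall rho, rho \in rels P <->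
    exists a b, [/\ a < narr P0, b < narr P0, rho = zrel K a b &
                    glued gl (src P0 a) (tgt P0 b)] }.

Lemma glue_state_id P : rels P = [::] -> glue_state P [::] P id.
Proof.
move=> rP; split=> //; first by rewrite addn0.
- by rewrite map_id_in // => -[].
- by move=> u v _ _; rewrite orbF.
- by move=> rho; rewrite rP; split=> // -[a [b []]].
Qed.

Lemma src_glue P0 gl P r a : glue_state P0 gl P r -> a < narr P0 -> src P a = r (src P0 a).
Proof. by move=> st ha; rewrite /src (glue_arrs st) (nth_map (0, 0)). Qed.

Lemma tgt_glue P0 gl P r a : glue_state P0 gl P r -> a < narr P0 -> tgt P a = r (tgt P0 a).
Proof. by move=> st ha; rewrite /tgt (glue_arrs st) (nth_map (0, 0)). Qed.

Lemma narr_glue P0 gl P r : glue_state P0 gl P r -> narr P = narr P0.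
Proof. by move=> st; rewrite /narr (glue_arrs st) size_map. Qed.

(** Neither [i] nor [j] occurs in an earlier pair, so each is the only original vertex over its
    current image. Hence [glue] adds exactly the relations between original arrows at [i] and at
    [j]. *)
Lemma glue_state_step P0 gl P r i j : wf_pres P0 -> glue_state P0 gl P r ->
  uniq (gl_vertices (rcons gl (i, j))) ->
  all (fun v => v < nv P0) (gl_vertices (rcons gl (i, j))) ->
  glue_state P0 (rcons gl (i, j)) (glue P (r i) (r j)) (gren (r i) (r j) \o r).
Proof.
move=> [wf0 _] st; rewrite -cats1 gl_vertices_cat cat_uniq all_cat /= !orbF inE !andbT.
rewrite negb_or => /and3P[_ /andP[ni nj] ij] /and3P[_ hi hj].
have gi u : glued gl u i = false.
  by apply: contraNF ni; rewrite glued_sym; apply: glued_mem.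
have gj u : glued gl u j = false.
  by apply: contraNF nj; rewrite glued_sym; apply: glued_mem.
have ei u : u < nv P0 -> (r u == r i) = (u == i).
  by move=> hu; rewrite (glue_eq st) // gi orbF.
have ej u : u < nv P0 -> (r u == r j) = (u == j).
  by move=> hu; rewrite (glue_eq st) // gj orbF.
have rij : r i != r j by rewrite ej.
have hs a : a < narr P0 -> src P a = r (src P0 a) by exact: src_glue st.
have ht a : a < narr P0 -> tgt P a = r (tgt P0 a) by exact: tgt_glue st.
have nP := narr_glue st.
split.
- by rewrite /= size_cat /=; have := glue_nv st; have := glue_lt st hi; lia.
- by rewrite /= (glue_arrs st) -map_comp.
- by move=> u hu; apply: gren_lt => //; apply: (glue_lt st).
- move=> u v hu hv; rewrite /= gren_eq // (glue_eq st) // cats1 glued_rcons !ei // !ej //.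
  by rewrite -orbA.
move=> rho; rewrite cats1 /= mem_cat; split.
  case/orP=> [/(glue_rels st)[a [b [ha hb -> g]]]|].
    by exists a, b; split; rewrite // glued_rcons g.
  case/mapP=> -[a b]; rewrite mem_filter => /andP[/= h] /allpairsP[[a' b'] /= [ha hb [? ?]]].
  subst a' b'; rewrite !mem_arrows nP in ha hb => ->.
  have [hsa _] := wf0 a ha; have [_ htb] := wf0 b hb.
  exists a, b; split=> //; rewrite glued_rcons; apply/orP; right.
  by move: h; rewrite hs // ht // !ei // !ej.
move=> [a [b [ha hb -> ]]]; rewrite glued_rcons => /orP[g|g].
  by apply/orP; left; apply/(glue_rels st); exists a, b.
apply/orP; right; apply/mapP; exists (a, b) => //; rewrite mem_filter /=.
have [hsa _] := wf0 a ha; have [_ htb] := wf0 b hb.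
rewrite hs // ht // !ei // !ej // g; apply/allpairsP; exists (a, b).
by rewrite !mem_arrows nP.
Qed.

(** The prefix [gl0] of pairs already glued makes the induction along [glue_all] possible. *)
Lemma glue_state_all P0 gl0 gl P r : wf_pres P0 -> glue_state P0 gl0 P r ->
  uniq (gl_vertices (gl0 ++ gl)) ->
  all (fun v => v < nv P0) (gl_vertices (gl0 ++ gl)) ->
  glue_state P0 (gl0 ++ gl) (glue_all P gl r).1 (glue_all P gl r).2.
Proof.
move=> wf0; elim: gl gl0 P r => [|[i j] gl IH] gl0 P r st; first by rewrite cats0.
rewrite -cat_rcons => u a; apply: IH => //; apply: glue_state_step => //.
  by move: u; rewrite gl_vertices_cat cat_uniq => /andP[].
by move: a; rewrite gl_vertices_cat all_cat => /andP[].
Qed.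

Lemma glue_all_state P gl : wf_pres P -> rels P = [::] ->
  uniq (gl_vertices gl) -> all (fun v => v < nv P) (gl_vertices gl) ->
  glue_state P gl (glue_all P gl id).1 (glue_all P gl id).2.
Proof. by move=> wf rP; apply: (@glue_state_all P [::]) => //; apply: glue_state_id. Qed.

Lemma glue_wf P gl Q r : wf_pres P -> glue_state P gl Q r -> wf_pres Q.
Proof.
move=> [wf _] st; split.
  move=> a; rewrite (narr_glue st) => ha; rewrite (src_glue st) // (tgt_glue st) //.
  by have [h1 h2] := wf a ha; split; apply: (glue_lt st).
move=> rho cp a /(glue_rels st)[a1 [b1 [h1 h2 -> _]]]; rewrite inE (narr_glue st) => /eqP->.
by rewrite !inE => /orP[]/eqP->.
Qed.

Lemma glue_inR P gl Q r a b : glue_state P gl Q r -> a < narr P -> b < narr P ->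
  inR Q a b = glued gl (src P a) (tgt P b).
Proof.
move=> st ha hb; apply/idP/idP; last by move=> g; apply/(glue_rels st); exists a, b.
by move=> /(glue_rels st)[a' [b' [_ _ [-> ->]]]].
Qed.

End Gluing.

(** * Gluings in type A and A~ give gentle presentations *)

Section GluedTypeA.
Variable K : fieldType.
Implicit Types (P Q : pres K) (gl : seq (nat * nat)).
Local Open Scope nat_scope.

Lemma size_le_count (T : eqType) (p : pred T) (s t : seq T) :
  uniq t -> (forall x, x \in t -> p x && (x \in s)) -> size t <= count p s.
Proof.
move=> ut h; rewrite -size_filter; apply: uniq_leq_size => // x xt.
by rewrite mem_filter h.
Qed.

Lemma count_le1 (T : eqType) (p : pred T) (s : seq T) : uniq s ->
  (forall x y, x \in s -> y \in s -> p x -> p y -> x = y) -> count p s <= 1.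
Proof.
move=> us h; rewrite -size_filter; have := filter_uniq p us.
have hm x : x \in filter p s -> p x /\ x \in s by rewrite mem_filter => /andP[].
case e : (filter p s) hm => [|x [|y t]] //= hm.
have [px xs] : p x /\ x \in s by apply: hm; rewrite inE eqxx.
have [py ys] : p y /\ y \in s by apply: hm; rewrite !inE eqxx orbT.
by rewrite (h x y) // inE eqxx.
Qed.

Lemma leq_in_count (T : eqType) (p q : pred T) (s : seq T) :
  {in s, forall x, p x -> q x} -> count p s <= count q s.
Proof.
elim: s => //= x s IH h; apply: leq_add.
  by have := h x (mem_head _ _); case: (p x) => // ->.
by apply: IH => y ys; apply: h; rewrite inE ys orbT.
Qed.

Lemma outdeg_gt0 P a v : a < narr P -> src P a = v -> 0 < outdeg P v.
Proof.
move=> ha hv; apply: (@size_le_count _ _ _ [:: a]) => // x.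
by rewrite inE => /eqP->; rewrite hv eqxx mem_arrows.
Qed.

Lemma indeg_gt0 P a v : a < narr P -> tgt P a = v -> 0 < indeg P v.
Proof.
move=> ha hv; apply: (@size_le_count _ _ _ [:: a]) => // x.
by rewrite inE => /eqP->; rewrite hv eqxx mem_arrows.
Qed.

Lemma outdeg_gt1 P a b v : a < narr P -> b < narr P -> a != b ->
  src P a = v -> src P b = v -> 1 < outdeg P v.
Proof.
move=> ha hb ab hv hw; apply: (@size_le_count _ _ _ [:: a; b]) => [|x].
  by rewrite /= inE ab.
by rewrite !inE => /orP[]/eqP->; rewrite ?hv ?hw eqxx mem_arrows.
Qed.

Lemma indeg_gt1 P a b v : a < narr P -> b < narr P -> a != b ->
  tgt P a = v -> tgt P b = v -> 1 < indeg P v.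
Proof.
move=> ha hb ab hv hw; apply: (@size_le_count _ _ _ [:: a; b]) => [|x].
  by rewrite /= inE ab.
by rewrite !inE => /orP[]/eqP->; rewrite ?hv ?hw eqxx mem_arrows.
Qed.

Lemma outdegP P v : reflect (exists2 a, a < narr P & src P a = v) (0 < outdeg P v).
Proof.
rewrite -has_count; apply: (iffP hasP) => -[a].
  by rewrite mem_arrows => h /eqP; exists a.
by move=> h1 h2; exists a; rewrite ?mem_arrows ?h2.
Qed.

Lemma indegP P v : reflect (exists2 a, a < narr P & tgt P a = v) (0 < indeg P v).
Proof.
rewrite -has_count; apply: (iffP hasP) => -[a].
  by rewrite mem_arrows => h /eqP; exists a.
by move=> h1 h2; exists a; rewrite ?mem_arrows ?h2.
Qed.

Section Glued.
Variables (P : pres K) (gl : seq (nat * nat)) (Q : pres K) (r : nat -> nat).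
Hypotheses (wfP : wf_pres P) (st : glue_state P gl Q r).
Hypotheses (ugl : uniq (gl_vertices gl)) (hgl : all (fun v => v < nv P) (gl_vertices gl)).

Let src_lt a : a < narr P -> src P a < nv P. Proof. by case: wfP => h _ /h[]. Qed.
Let tgt_lt a : a < narr P -> tgt P a < nv P. Proof. by case: wfP => h _ /h[]. Qed.

Lemma glued_irr u : glued gl u u = false.
Proof. by apply/negP => g; have [] := glued_unique ugl g g; rewrite eqxx. Qed.

Lemma outdeg_unglued u : u < nv P -> u \notin gl_vertices gl -> outdeg Q (r u) = outdeg P u.
Proof.
move=> hu nu; rewrite /outdeg /arrows (narr_glue st); apply: eq_in_count => a.
rewrite mem_iota /= => ha; rewrite (src_glue st) // (glue_eq st) ?src_lt // glued_sym.
by rewrite (negbTE (contra (@glued_mem _ _ _) nu)) orbF.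
Qed.

Lemma indeg_unglued u : u < nv P -> u \notin gl_vertices gl -> indeg Q (r u) = indeg P u.
Proof.
move=> hu nu; rewrite /indeg /arrows (narr_glue st); apply: eq_in_count => a.
rewrite mem_iota /= => ha; rewrite (tgt_glue st) // (glue_eq st) ?tgt_lt // glued_sym.
by rewrite (negbTE (contra (@glued_mem _ _ _) nu)) orbF.
Qed.

(** By [glued_unique] an arrow starting at the glued vertex originally started at [u] or at [v]. *)
Lemma outdeg_glued u v : glued gl u v -> outdeg Q (r u) <= outdeg P u + outdeg P v.
Proof.
move=> g; have hu : u < nv P by apply: (allP hgl); apply: glued_mem g.
rewrite /outdeg -count_predUI; apply: leq_trans (leq_addr _ _).
rewrite /arrows (narr_glue st); apply: leq_in_count => a.
rewrite mem_iota /= => ha; rewrite (src_glue st) // (glue_eq st) ?src_lt //.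
case: eqP => //= _; rewrite glued_sym => g'; apply/eqP.
by have [] := glued_unique ugl g' g.
Qed.

Lemma indeg_glued u v : glued gl u v -> indeg Q (r u) <= indeg P u + indeg P v.
Proof.
move=> g; have hu : u < nv P by apply: (allP hgl); apply: glued_mem g.
rewrite /indeg -count_predUI; apply: leq_trans (leq_addr _ _).
rewrite /arrows (narr_glue st); apply: leq_in_count => a.
rewrite mem_iota /= => ha; rewrite (tgt_glue st) // (glue_eq st) ?tgt_lt //.
case: eqP => //= _; rewrite glued_sym => g'; apply/eqP.
by have [] := glued_unique ugl g' g.
Qed.

Hypothesis tA : typeA_Atilde P.
Hypothesis deg1 : forall v, v \in gl_vertices gl -> outdeg P v <= 1 /\ indeg P v <= 1.

(** Arrows with a common source in [Q] start at one vertex of [P] or at two glued ones. In the first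
    case that vertex has outdegree two, so it is not glued and receives no arrow. In the second, an
    incoming arrow ends at one of the two vertices and forms a relation exactly with the arrow
    starting at the other. Common targets are dual. *)
Lemma glued_typeA_gentle : gentle_pres Q.
Proof.
have nQ := narr_glue st.
have d2 v : outdeg P v <= 2 /\ indeg P v <= 2.
  by have := typeA_deg v tA; split; lia.
split; first exact: glue_wf st.
split.
  move=> w; split.
    have [/outdegP[a]|] := boolP (0 < outdeg Q w); last by lia.
    rewrite nQ => ha; rewrite (src_glue st) // => <-.
    have [/glued_exists[v g]|nu] := boolP (src P a \in gl_vertices gl).
      have [d _] := deg1 (glued_mem g); have := g; rewrite glued_sym => /glued_mem/deg1[d' _].
      by have := outdeg_glued g; lia.
    by rewrite outdeg_unglued ?src_lt //; have [] := d2 (src P a).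
  have [/indegP[a]|] := boolP (0 < indeg Q w); last by lia.
  rewrite nQ => ha; rewrite (tgt_glue st) // => <-.
  have [/glued_exists[v g]|nu] := boolP (tgt P a \in gl_vertices gl).
    have [_ d] := deg1 (glued_mem g); have := g; rewrite glued_sym => /glued_mem/deg1[_ d'].
    by have := indeg_glued g; lia.
  by rewrite indeg_unglued ?tgt_lt //; have [] := d2 (tgt P a).
split; first by move=> rho /(glue_rels st)[a [b [_ _ -> _]]]; exists a, b.
rewrite nQ; split.
  move=> a1 a2 b h1 h2 hb n12; rewrite !(src_glue st) // (tgt_glue st) //.
  rewrite !(glue_inR st) // => /eqP; rewrite (glue_eq st) ?src_lt //.
  case/orP=> [/eqP e|g] /eqP; rewrite (glue_eq st) ?src_lt ?tgt_lt //.
    have o2 := outdeg_gt1 h1 h2 n12 erefl (esym e).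
    case/orP=> [/eqP et|g].
      have := indeg_gt0 hb et; have := typeA_deg (src P a1) tA; lia.
    by move: g; rewrite glued_sym => /glued_mem/deg1; lia.
  case/orP=> [/eqP->|g'].
    by rewrite glued_irr (glued_sym _ (src P a2)) g.
  rewrite glued_sym in g'; have [_ <-] := glued_unique ugl g g'.
  by rewrite glued_irr g.
move=> b1 b2 a h1 h2 ha n12; rewrite !(tgt_glue st) // (src_glue st) //.
rewrite !(glue_inR st) // => /eqP; rewrite (glue_eq st) ?tgt_lt //.
case/orP=> [/eqP e|g] /eqP; rewrite (glue_eq st) ?src_lt ?tgt_lt //.
  have o2 := indeg_gt1 h1 h2 n12 erefl (esym e).
  case/orP=> [/eqP et|g].
    have := outdeg_gt0 ha et; have := typeA_deg (tgt P b1) tA; lia.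
  by move: g; rewrite glued_sym => /glued_mem/deg1; lia.
case/orP=> [/eqP->|g'].
  by rewrite glued_irr g.
rewrite glued_sym in g'; have [_ <-] := glued_unique ugl g g'.
by rewrite glued_irr (glued_sym _ (tgt P b2)) g.
Qed.

(** Only [v] lies over [r v], so a loop there would come from a loop of the acyclic quiver, and a
    relation there would require [v] to be glued. *)
Lemma unglued_sg_vertex v : acyclic P -> v < nv P -> v \notin gl_vertices gl ->
  outdeg P v <= 1 -> indeg P v <= 1 -> sg_vertex Q (r v).
Proof.
move=> ac hv nv o1 i1; have nQ := narr_glue st.
have ng u : glued gl v u = false by apply: contraNF nv; apply: glued_mem.
have req u : u < Defs.nv P -> r u = r v -> u = v.
  by move=> hu /eqP; rewrite (glue_eq st) // glued_sym ng orbF => /eqP.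
split; first exact: glue_lt st _ hv.
rewrite outdeg_unglued // indeg_unglued //; split=> //; split=> //; rewrite nQ; split.
  move=> a ha; rewrite (src_glue st) // (tgt_glue st) // => /req-/(_ (src_lt ha)) es.
  by move=> /req-/(_ (tgt_lt ha)) et; apply: (ac a ha); rewrite es et; apply: reach_refl.
move=> a b ha hb; rewrite (src_glue st) // (tgt_glue st) // => /req-/(_ (src_lt ha)) es _.
by rewrite (glue_inR st) // es ng.
Qed.

End Glued.

(** The renamed vertices to be blown up stay distinct since none of them is glued. The lengths are
    compared in order to treat the case of gluings only. *)
Lemma skewed_gentle_of_typeA P gl bl : hereditary_pres P -> typeA_Atilde P ->
  suitable P gl bl ->
  (forall v, v \in seq_vertices gl bl -> outdeg P v <= 1 /\ indeg P v <= 1) ->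
  exists Q bl', [/\ gentle_pres Q, uniq bl', forall i, i \in bl' -> sg_vertex Q i,
     apply_seq P gl bl = blow_all Q bl' & size bl' = size bl].
Proof.
move=> [wf [rP ac]] tA [uV aV] dV.
have := uV; rewrite /seq_vertices cat_uniq => /and3P[ugl dis ubl].
have := aV; rewrite /seq_vertices all_cat => /andP[agl abl].
have st := glue_all_state wf rP ugl agl.
rewrite /apply_seq; move: st; case: (glue_all P gl id) => Q r /= st.
have nbl v : v \in bl -> v \notin gl_vertices gl.
  by move=> vb; apply: contra dis => vg; apply/hasP; exists v.
exists Q, (map r bl); split=> //; last by rewrite size_map.
- apply: (glued_typeA_gentle wf st) => // v vg; apply: dV; by rewrite mem_cat vg.
- rewrite map_inj_in_uniq // => u v ub vb /eqP; rewrite (glue_eq st) ?(allP abl) //.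
  case/orP=> [/eqP//|/glued_mem ug]; by rewrite (negPf (nbl _ ub)) in ug.
- move=> i /mapP[v vb ->]; have [|o1 i1] := dV v; first by rewrite mem_cat vb orbT.
  by apply: (unglued_sg_vertex wf st) => //; [exact: (allP abl) | exact: nbl].
Qed.

End GluedTypeA.

(** * Blowing up: copies of arrows and of relations *)

Section BlowingUp.
Variable K : fieldType.
Implicit Types (P Q S : pres K) (rho : seq (K * seq nat)).
Local Open Scope nat_scope.

(** The half of [wf_pres] on arrows, which is the one carried through blowings up. *)
Definition wf_arrows P := forall a, a < narr P -> src P a < nv P /\ tgt P a < nv P.

(** [swv] and [cpy] give the numbers of second copies of vertices and arrows; whatever does not
    touch [i] is its own copy. *)
Definition swv P i v := if v == i then nv P else v.
Definition cpy P i a := if atv P i a then dbl P i a else a.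

Lemma swv_inj P i u v : u < nv P -> v < nv P -> swv P i u = swv P i v -> u = v.
Proof. by rewrite /swv; case: eqP => ?; case: eqP => ?; lia. Qed.

Lemma swv_lt P i v : v < nv P -> swv P i v < (nv P).+1.
Proof. by rewrite /swv; case: eqP => ?; lia. Qed.

Lemma narr_blowup P i : narr (blowup P i) = narr P + size (arrs_at P i).
Proof. by rewrite /narr /= size_cat size_map. Qed.

Lemma mem_arrs_at P i a : (a \in arrs_at P i) = atv P i a && (a < narr P).
Proof. by rewrite mem_filter mem_arrows. Qed.

Lemma src_blowup P i a : a < narr P -> src (blowup P i) a = src P a.
Proof. by move=> ha; rewrite /src /= nth_cat ha. Qed.

Lemma tgt_blowup P i a : a < narr P -> tgt (blowup P i) a = tgt P a.
Proof. by move=> ha; rewrite /tgt /= nth_cat ha. Qed.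

Lemma nth_dbl P i a : a \in arrs_at P i ->
  nth (0, 0) (arrs (blowup P i)) (dbl P i a) = (swv P i (src P a), swv P i (tgt P a)).
Proof.
move=> ha; rewrite /= nth_cat /dbl -/(narr P) ltnNge leq_addr /= addKn.
by rewrite (nth_map 0) ?index_mem // nth_index.
Qed.

Lemma cpy_lt P i a : a < narr P -> cpy P i a < narr (blowup P i).
Proof.
move=> ha; rewrite /cpy narr_blowup; case: ifP => h; last exact: ltn_addr.
by rewrite ltn_add2l index_mem mem_arrs_at h.
Qed.

Lemma src_cpy P i a : a < narr P -> src (blowup P i) (cpy P i a) = swv P i (src P a).
Proof.
move=> ha; rewrite /cpy; case: ifP => h.
  by rewrite /src nth_dbl // mem_arrs_at h.
by rewrite src_blowup // /swv; move: h; rewrite /atv; case: eqP.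
Qed.

Lemma tgt_cpy P i a : a < narr P -> tgt (blowup P i) (cpy P i a) = swv P i (tgt P a).
Proof.
move=> ha; rewrite /cpy; case: ifP => h.
  by rewrite /tgt nth_dbl // mem_arrs_at h.
by rewrite tgt_blowup // /swv; move: h; rewrite /atv orbC; case: eqP.
Qed.

Lemma blowup_arrowP P i c : c < narr (blowup P i) ->
  c < narr P \/ exists2 a, a < narr P & c = cpy P i a.
Proof.
rewrite narr_blowup => h; case: (ltnP c (narr P)) => hc; [by left | right].
have hk : c - narr P < size (arrs_at P i) by lia.
have := mem_nth 0 hk; rewrite mem_arrs_at => /andP[h1 h2].
exists (nth 0 (arrs_at P i) (c - narr P)) => //.
rewrite /cpy h1 /dbl index_uniq ?subnKC //.
by rewrite filter_uniq // iota_uniq.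
Qed.

Lemma wf_arrows_blowup P i : wf_arrows P -> wf_arrows (blowup P i).
Proof.
move=> wf c /blowup_arrowP[hc|[a ha ->]].
  by rewrite src_blowup // tgt_blowup //; have [] := wf c hc; rewrite /=; lia.
by rewrite src_cpy // tgt_cpy //; have [h1 h2] := wf a ha; split; apply: swv_lt.
Qed.

Definition cpy_rel P i rho := [seq (cp.1, map (cpy P i) cp.2) | cp <- rho].
Definition rel_at P i rho := has (fun cp : K * seq nat => has (atv P i) cp.2) rho.
Definition diff_rel (b a d c : nat) : seq (K * seq nat) :=
  [:: (1%R, [:: b; a]); ((-1)%R, [:: d; c])].

(** Both arrows at a new commutativity relation touch [i], so their doubles are their values under
    [cpy]; thus one copying map describes all kinds of relations. *)
Lemma blowup_relsP P i rho : rho \in rels (blowup P i) <->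
  [\/ rho \in rels P,
      exists2 rho0, rho0 \in rels P & rel_at P i rho0 /\ rho = cpy_rel P i rho0 |
      exists b a, [/\ b < narr P, a < narr P, src P b = i, tgt P a = i &
                     rho = diff_rel b a (cpy P i b) (cpy P i a)]].
Proof.
rewrite /= mem_cat; split.
  case/orP=> [/flatten_mapP[rho0 h0]|/mapP[[b a]]].
    rewrite -/(rel_at P i rho0); case: ifP => hat; rewrite !inE.
      by case/orP=> /eqP->; [constructor 1 | constructor 2; exists rho0].
    by move/eqP->; constructor 1.
  rewrite mem_filter => /andP[/= /andP[/eqP e1 /eqP e2]] /allpairsP[[b' a'] /= []].
  rewrite !mem_arrows => hb ha [eb ea] ->; subst b' a'.
  constructor 3; exists b, a; split=> //.
  by rewrite /cpy /atv e1 e2 !eqxx orbT.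
case=> [h|[rho0 h0 [hat ->]]|[b [a [hb ha e1 e2 ->]]]].
- apply/orP; left; apply/flatten_mapP; exists rho => //.
  by case: ifP => _; rewrite !inE eqxx.
- apply/orP; left; apply/flatten_mapP; exists rho0 => //.
  by rewrite -/(rel_at P i rho0) hat !inE eqxx orbT.
apply/orP; right; apply/mapP; exists (b, a).
  rewrite mem_filter /= e1 e2 !eqxx; apply/allpairsP; exists (b, a).
  by rewrite !mem_arrows.
by rewrite /cpy /atv e1 e2 !eqxx orbT.
Qed.

(* Products of non-composable arrows vanish in every algebra satisfying P. *)
Definition non_composable P rho :=
  exists a b, [/\ a < narr P, b < narr P, src P a <> tgt P b & rho = zrel K a b].

(** A gentle presentation may list products of non-composable arrows, which gluing never creates;
    presentations are therefore compared up to such relations. *)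
Definition rels_implied P Q :=
  [/\ nv P = nv Q, arrs P = arrs Q &
      forall rho, rho \in rels P -> rho \in rels Q \/ non_composable Q rho].

(** Equal quivers have equal copying maps, and copies of non-composable arrows remain non-composable
    because [swv] is injective on vertices. *)
Lemma rels_implied_blowup P Q i : wf_arrows Q -> rels_implied P Q ->
  rels_implied (blowup P i) (blowup Q i).
Proof.
move=> wf [eN eA h].
have eS a : src P a = src Q a by rewrite /src eA.
have eT a : tgt P a = tgt Q a by rewrite /tgt eA.
have en : narr P = narr Q by rewrite /narr eA.
have eat a : atv P i a = atv Q i a by rewrite /atv eS eT.
have ear : arrs_at P i = arrs_at Q i by rewrite /arrs_at /arrows en; apply: eq_filter.
have ecp : cpy P i =1 cpy Q i by move=> a; rewrite /cpy eat /dbl en ear.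
have ecr rho : cpy_rel P i rho = cpy_rel Q i rho.
  by apply: eq_map => cp; rewrite (eq_map ecp).
have era rho : rel_at P i rho = rel_at Q i rho.
  by apply: eq_has => cp; apply: eq_has => a.
split; first by rewrite /= eN.
  by rewrite /= eA ear; congr cat; apply: eq_map => a; rewrite eS eT eN.
move=> rho /blowup_relsP[/h[h1|[a [b [ha hb ne ->]]]]|[rho0 /h[h1|]]|[b [a [hb ha e1 e2 ->]]]].
- by left; apply/blowup_relsP; constructor 1.
- right; exists a, b; rewrite src_blowup // tgt_blowup // narr_blowup.
  by split=> //; apply: ltn_addr.
- rewrite era ecr => -[hat ->]; left; apply/blowup_relsP; constructor 2.
  by exists rho0.
- move=> [a [b [ha hb ne ->]]] [_]; rewrite ecr => ->; right.
  exists (cpy Q i a), (cpy Q i b); split=> //; rewrite ?cpy_lt // src_cpy // tgt_cpy //.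
  by move/swv_inj => e; apply: ne; apply: e; [case: (wf a ha) | case: (wf b hb)].
- left; apply/blowup_relsP; constructor 3; exists b, a; rewrite -en -eS -eT !ecp.
  by split.
Qed.

Lemma rels_implied_blow_all P Q bl : wf_arrows Q -> rels_implied P Q ->
  rels_implied (blow_all P bl) (blow_all Q bl).
Proof.
elim: bl P Q => //= i bl IH P Q wf h; apply: IH; first exact: wf_arrows_blowup.
exact: rels_implied_blowup.
Qed.

Lemma wf_arrows_blow_all P bl : wf_arrows P -> wf_arrows (blow_all P bl).
Proof. by elim: bl P => //= i bl IH P wf; apply/IH/wf_arrows_blowup. Qed.

Lemma evalrel_zrel (B : falgType K) (x : nat -> B) a b :
  evalrel x (zrel K a b) = (x a * x b)%R.
Proof. by rewrite /evalrel /zrel big_seq1 /= scale1r big_cons big_seq1. Qed.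

Lemma evalrel_diff (B : falgType K) (x : nat -> B) b a d c :
  evalrel x (diff_rel b a d c) = (x b * x a - x d * x c)%R.
Proof.
by rewrite /evalrel /diff_rel big_cons big_seq1 /= scale1r scaleN1r !big_cons !big_nil !mulr1.
Qed.

(** In a product of non-composable arrows two distinct orthogonal idempotents meet in the middle. *)
Lemma satisfies_implied P Q (B : falgType K) (e x : nat -> B) :
  wf_arrows Q -> rels_implied P Q -> satisfies Q e x -> satisfies P e x.
Proof.
move=> wf [eN eA h] [h1 [h2 [h3 h4]]]; split; first by rewrite eN.
split; first by rewrite eN.
split; first by move=> a; rewrite /narr /src /tgt eA; apply: h3.
move=> rho /h[/h4//|[a [b [ha hb ne ->]]]].
rewrite evalrel_zrel (h3 a ha) (h3 b hb).
have [sa _] := wf a ha; have [_ tb] := wf b hb.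
rewrite mulrA -[(_ * e (src Q a) * _)%R]mulrA (mulrA (e (src Q a))) h1 //.
by rewrite (introF eqP ne) !(mul0r, mulr0).
Qed.

Lemma presents_equiv (A : falgType K) P Q : wf_arrows P -> wf_arrows Q ->
  rels_implied P Q -> rels_implied Q P -> presents A P -> presents A Q.
Proof.
move=> wP wQ pq qp [e [x [h1 [h2 h3]]]]; have [eN eA _] := pq.
exists e, x; split; first exact: satisfies_implied h1.
split; first by rewrite -eN /arrows /narr -eA.
move=> B e' x' sat; have [|f [f1 f2]] := h3 B e' x'; first exact: satisfies_implied sat.
by exists f; rewrite -eN /narr -eA.
Qed.

(* S is an iterated blow-up of P0 and [o] sends each arrow copy to the arrow
   of P0 that it comes from. *)
Record cover P0 S (o : nat -> nat) : Prop := Cover {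
  cover_wf : wf_arrows S;
  cover_narr : narr P0 <= narr S;
  cover_old : forall a, a < narr P0 ->
    [/\ src S a = src P0 a, tgt S a = tgt P0 a & o a = a];
  cover_rels : forall rho, rho \in rels S ->
    (exists a b, [/\ a < narr S, b < narr S, rho = zrel K a b & inR P0 (o a) (o b)]) \/
    (exists b a d c, [/\ [/\ b < narr S, a < narr S, d < narr S & c < narr S],
       rho = diff_rel b a d c, o b = o d /\ o a = o c,
       src S b = tgt S a /\ src S d = tgt S c & tgt S b = tgt S d /\ src S a = src S c]) }.

Lemma cover_id P : wf_pres P ->
  (forall rho, rho \in rels P -> exists a b, rho = zrel K a b) -> cover P P id.
Proof.
move=> [wf1 wf2] h; split=> // rho hr; left; have [a [b e]] := h rho hr.
exists a, b; rewrite /inR -e; split=> //; rewrite e in hr.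
  by apply: (wf2 _ _ _ hr (mem_head _ _)); rewrite mem_head.
by apply: (wf2 _ _ _ hr (mem_head _ _)); rewrite !inE eqxx orbT.
Qed.

(** Since [i] has no loops, the arrow leaving [i] in a new commutativity relation ends away from
    [i], and the arrow entering [i] starts away from [i]; so both paths have the same ends. *)
Lemma cover_blowup P0 S o i :
  (forall a, a < narr S -> src S a = i -> tgt S a <> i) -> cover P0 S o ->
  exists o', cover P0 (blowup S i) o'.
Proof.
move=> nl [wf nS old rS].
(* Doubles are numbered after the old arrows, in the order of [arrs_at S i]; each lies over the same
   arrow as its original. *)
pose o' c := if c < narr S then o c else o (nth 0 (arrs_at S i) (c - narr S)).
have o1 c : c < narr S -> o' c = o c by rewrite /o' => ->.
have o2 c : c < narr S -> o' (cpy S i c) = o c.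
  move=> hc; rewrite /cpy; case: ifP => h; last exact: o1.
  by rewrite /o' /dbl ltnNge leq_addr /= addKn nth_index // mem_arrs_at h.
have lt1 a : a < narr S -> a < narr (blowup S i).
  by move=> h; rewrite narr_blowup ltn_addr.
exists o'; split; first exact: wf_arrows_blowup.
- by rewrite narr_blowup (leq_trans nS) ?leq_addr.
- move=> a ha; have hS := leq_trans ha nS.
  by rewrite src_blowup // tgt_blowup // o1 //; apply: old.
move=> rho /blowup_relsP[/rS[]|[rho0 /rS[]]|].
- move=> [a [b [ha hb -> hr]]]; left; exists a, b.
  by rewrite !o1 //; split=> //; apply: lt1.
- move=> [b [a [d [c [[hb ha hd hc] -> [e1 e2] [e3 e4] [e5 e6]]]]]]; right.
  exists b, a, d, c; rewrite !o1 // !src_blowup // !tgt_blowup //.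
  by split=> //; split; apply: lt1.
- move=> [a [b [ha hb -> hr]]] [_ ->]; left; exists (cpy S i a), (cpy S i b).
  by rewrite !o2 //; split=> //; apply: cpy_lt.
- move=> [b [a [d [c [[hb ha hd hc] -> [e1 e2] [e3 e4] [e5 e6]]]]]] [_ ->]; right.
  exists (cpy S i b), (cpy S i a), (cpy S i d), (cpy S i c).
  rewrite !o2 // !src_cpy // !tgt_cpy // e1 e2 e3 e4 e5 e6.
  by split=> //; split; apply: cpy_lt.
- move=> [b [a [hb ha e1 e2 ->]]]; right.
  exists b, a, (cpy S i b), (cpy S i a).
  rewrite !o2 // !o1 // !src_cpy // !tgt_cpy // !src_blowup // !tgt_blowup // e1 e2.
  split=> //; first by split; first [exact: lt1 | exact: cpy_lt].
  rewrite /swv (introF eqP (nl b hb e1)); case: eqP => // e3.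
  by case: (nl a ha e3).
Qed.

(** The copies of arrows replace only [i], and by the new number [nv P], which is larger than
    [j]. *)
Lemma no_loops_blowup P i j :
  wf_arrows P -> j < nv P -> i != j ->
  (forall a, a < narr P -> src P a = j -> tgt P a <> j) ->
  (forall a, a < narr (blowup P i) -> src (blowup P i) a = j -> tgt (blowup P i) a <> j).
Proof.
move=> wf hj ij h c /blowup_arrowP[hc|[a ha ->]].
  by rewrite src_blowup // tgt_blowup //; apply: h.
rewrite src_cpy // tgt_cpy // /swv; case: eqP => [_ e|_]; first by lia.
by case: eqP => [_ _ e|_]; [lia | apply: h].
Qed.

Lemma cover_blow_all P0 S o bl : uniq bl ->
  (forall i, i \in bl -> i < nv S /\
     forall a, a < narr S -> src S a = i -> tgt S a <> i) ->
  cover P0 S o -> exists o', cover P0 (blow_all S bl) o'.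
Proof.
elim: bl S o => [|i bl IH] S o /=; first by exists o.
move=> /andP[ni ubl] h cov.
have [hi nl] := h i (mem_head _ _).
have [o' cov'] := cover_blowup nl cov.
apply: IH cov' => // j jb; have [hj nlj] := h j (mem_behead (s := i :: bl) jb).
split; first by rewrite /= ltnS ltnW.
apply: no_loops_blowup => //; first exact: cover_wf cov.
by apply: contraNneq ni => ->.
Qed.

End BlowingUp.

(** * Matrices of partial maps *)

Section PartialMapMatrices.
Variables (K : fieldType) (n : nat).
Implicit Types f g : 'I_n.+1 -> option 'I_n.+1.

(** Column convention: the basis vector [j] goes to that of [f j], or to zero where [f] is
    undefined, so composition becomes the matrix product. *)
Definition pmap_mx f : 'M[K]_n.+1 := \matrix_(i, j) (f j == Some i)%:R.

Lemma pmap_mxM f g : pmap_mx f * pmap_mx g = pmap_mx (fun j => obind f (g j)).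
Proof.
apply/matrixP=> i j; rewrite !mxE; case e : (g j) => [k|] /=; last first.
  by rewrite big1 // => l _; rewrite !mxE e mulr0.
rewrite (bigD1 k) //= !mxE e eqxx mulr1 big1 ?addr0 // => l lk.
by rewrite !mxE e (inj_eq Some_inj) [k == l]eq_sym (negPf lk) mulr0.
Qed.

Lemma eq_pmap_mx f g : f =1 g -> pmap_mx f = pmap_mx g.
Proof. by move=> h; apply/matrixP=> i j; rewrite !mxE h. Qed.

Lemma pmap_mx0 f : (forall j, f j = None) -> pmap_mx f = 0.
Proof. by move=> h; apply/matrixP=> i j; rewrite !mxE h. Qed.

End PartialMapMatrices.

(** * Dimension bounds from relation-free walks *)

Section LongWalks.
Variables (K : fieldType) (P0 S : pres K) (o : nat -> nat).
Hypothesis cov : cover P0 S o.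
Variables (N : nat) (walk : nat -> nat).
Hypothesis walk_lt : forall t, (t <= N)%N -> (walk t < narr P0)%N.
Hypothesis walkE : forall t, (t < N)%N -> tgt P0 (walk t) = src P0 (walk t.+1).
Hypothesis walk_free : forall t, (t < N)%N -> ~~ inR P0 (walk t.+1) (walk t).

(** The number of states is written as [M.+1] because square matrices form a unital algebra with
    nonzero unit in successor size. *)
Local Notation M := (nv S * N.+1).-1.
Local Notation state := 'I_M.+1.

Let wfS := cover_wf cov.

Let nS : (0 < nv S)%N.
Proof.
have h := leq_trans (walk_lt (leq0n N)) (cover_narr cov).
by have [+ _] := wfS h; apply: leq_ltn_trans.
Qed.

Let ME : M.+1 = (nv S * N.+1)%N.
Proof. by rewrite prednK // muln_gt0 nS. Qed.

(* The states of the walk module are the pairs (vertex, time), with time at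
   most N; an arrow acts at time t only if it is a copy of [walk t]. *)
Definition vert (s : state) : nat := (s %/ N.+1)%N.
Definition time (s : state) : nat := (s %% N.+1)%N.
Definition mkst (v t : nat) : state := inord (v * N.+1 + t).

Let mkst_val v t : (v < nv S)%N -> (t <= N)%N -> mkst v t = (v * N.+1 + t)%N :> nat.
Proof.
move=> hv ht; rewrite inordK // ME.
have : (v.+1 * N.+1 <= nv S * N.+1)%N by rewrite leq_mul2r hv orbT.
by rewrite mulSn; lia.
Qed.

Lemma vert_mkst v t : (v < nv S)%N -> (t <= N)%N -> vert (mkst v t) = v.
Proof. by move=> hv ht; rewrite /vert mkst_val // divnMDl // divn_small ?addn0. Qed.

Lemma time_mkst v t : (v < nv S)%N -> (t <= N)%N -> time (mkst v t) = t.
Proof. by move=> hv ht; rewrite /time mkst_val // modnMDl modn_small. Qed.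

Lemma vert_lt s : (vert s < nv S)%N.
Proof. by rewrite /vert ltn_divLR //; have := ltn_ord s; rewrite {2}ME. Qed.

Definition vstep v (s : state) := if vert s == v then Some s else None.
Definition astep c (s : state) :=
  if [&& vert s == src S c, time s < N & walk (time s) == o c]%N
  then Some (mkst (tgt S c) (time s).+1) else None.

Definition walk_e v : 'M[K]_M.+1 := pmap_mx K (vstep v).
Definition walk_x c : 'M[K]_M.+1 := pmap_mx K (astep c).

(** A monomial relation could act nontrivially only along two consecutive steps of the walk, whose
    product is not a relation of [P0]. In a difference relation both paths lie over the same arrows
    and share their ends, so they move the states in the same way. *)
Lemma walk_satisfies : satisfies S walk_e walk_x.
Proof.
split.
  move=> v w hv hw; rewrite /walk_e pmap_mxM; have [->|vw] := eqVneq v w.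
    by apply: eq_pmap_mx => s; rewrite /vstep; case: eqP => //= ->; rewrite eqxx.
  apply: pmap_mx0 => s; rewrite /vstep; case: eqP => //= ->.
  by rewrite eq_sym (negPf vw).
split.
  apply/matrixP=> i j; rewrite summxE (bigD1 (Ordinal (vert_lt j))) //= big1 => [|v vj].
    by rewrite !mxE /vstep eqxx addr0 (inj_eq Some_inj) eq_sym.
  rewrite !mxE /vstep ifN //; apply: contraNneq vj => e; exact/eqP/val_inj.
split.
  move=> c hc; rewrite /walk_e /walk_x !pmap_mxM; apply: eq_pmap_mx => s.
  have [_ ht] := wfS hc; rewrite /vstep /astep; case: (vert s =P _) => //= e.
  rewrite e eqxx /=; case: ifP => //= /andP[h _].
  by rewrite /= vert_mkst // eqxx.
move=> rho /(cover_rels cov)[].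
  move=> [a [b [ha hb -> hr]]]; rewrite evalrel_zrel /walk_x pmap_mxM.
  apply: pmap_mx0 => s; have [_ ht] := wfS hb.
  rewrite /astep; case: ifP => //= /and3P[_ h /eqP e].
  rewrite time_mkst //; case: ifP => // /and3P[_ h' /eqP e'].
  by have := walk_free h; rewrite e e' hr.
move=> [b [a [d [c [[hb ha hd hc] -> [e1 e2] [e3 e4] [e5 e6]]]]]].
rewrite evalrel_diff /walk_x !pmap_mxM; apply/eqP; rewrite subr_eq0; apply/eqP.
apply: eq_pmap_mx => s; have [_ ta] := wfS ha; have [_ tc] := wfS hc.
rewrite /astep e6 e2; case: ifP => //= /and3P[_ h _].
by rewrite !vert_mkst // !time_mkst // e3 e4 !eqxx /= e1 e5.
Qed.

(** Universality turns the walk module into a representation of [A]. The products along initial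
    pieces of the walk send the starting state to states at pairwise distinct times, so these [N.+1]
    elements are linearly independent. *)
Lemma walk_dim (A : falgType K) : presents A S -> (N < \dim {: A})%N.
Proof.
move=> [e [x [_ [_ univ]]]]; have [f [_ fx]] := univ _ _ _ walk_satisfies.
have f1 : f 1 = 1 by rewrite rmorph1.
have fM u v : f (u * v) = f u * f v by rewrite rmorphM.
pose fix word m : A := if m is m'.+1 then x (walk m') * word m' else 1.
pose st t := mkst (src P0 (walk t)) t.
have oldS t : (t <= N)%N -> [/\ (walk t < narr S)%N, src S (walk t) = src P0 (walk t),
    tgt S (walk t) = tgt P0 (walk t) & o (walk t) = walk t].
  move=> ht; have h := walk_lt ht; have [-> -> ->] := cover_old cov h.
  by split=> //; apply: leq_trans h (cover_narr cov).
have src_lt t : (t <= N)%N -> (src P0 (walk t) < nv S)%N.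
  by move=> ht; have [h <- _ _] := oldS t ht; have [] := wfS h.
have fword m : (m <= N)%N -> forall i, f (word m) i (st 0%N) = (st m == i)%:R.
  elim: m => [_ i|m IH hm i] /=; first by rewrite f1 mxE eq_sym.
  have hm' := ltnW hm; have [h1 h2 h3 h4] := oldS m hm'.
  rewrite fM fx // mxE (bigD1 (st m)) //= IH // eqxx mulr1 big1 => [|k kn].
    rewrite addr0 mxE /astep /st vert_mkst ?src_lt // time_mkst ?src_lt // h2 h4 hm !eqxx /=.
    by rewrite (inj_eq Some_inj) h3 walkE.
  by rewrite IH // eq_sym (negPf kn) mulr0.
have stI m m' : (m <= N)%N -> (m' <= N)%N -> (st m == st m') = (m == m').
  move=> h h'; apply/eqP/eqP => [eq|->//].
  by have := congr1 time eq; rewrite !time_mkst ?src_lt.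
pose X := [tuple word (m : nat) | m < N.+1].
have fX : free X.
  (* The entry in row [st m] and column [st 0] of a linear dependence isolates the coefficient of
     [word m]. *)
  apply/freeP => k ek m; have := congr1 (fun y => f y (st m) (st 0%N)) ek.
  rewrite /= linear_sum summxE linear0 mxE (bigD1 m) //= big1 => [|m' mm'].
    by rewrite addr0 linearZ mxE nth_mktuple fword -1?ltnS // eqxx mulr1.
  rewrite linearZ mxE nth_mktuple fword -1?ltnS // stI -1?ltnS //.
  by rewrite (inj_eq val_inj) (negPf mm') mulr0.
have := fX; rewrite /free size_tuple => /eqP <-.
by apply: dimvS; apply: subvf.
Qed.

End LongWalks.

(** * Walks around oriented cycles *)

Section Cycles.
Variables (K : fieldType) (P : pres K).
Local Open Scope nat_scope.

Lemma reach_trans u v w : reach P u v -> reach P v w -> reach P u w.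
Proof. by elim=> // a {}v ha _ IH /IH; apply: reach_step. Qed.

(** Induction on the length: the arrow chosen after [a] lies on a closed path again, so the walk can
    always be continued. *)
Lemma cycle_walk a N : a < narr P -> reach P (tgt P a) (src P a) ->
  exists walk, [/\ walk 0 = a, forall t, t <= N -> walk t < narr P &
                   forall t, t < N -> tgt P (walk t) = src P (walk t.+1)].
Proof.
elim: N a => [|N IH] a ha hr; first by exists (fun=> a).
(* The next arrow is the first one on the path from the target of [a] back to its source; if that
   path is trivial, [a] is a loop and follows itself. *)
have [a' [ha' hr' e]] : exists a', [/\ a' < narr P, reach P (tgt P a') (src P a') &
    tgt P a = src P a'].
  move: (hr); move e1: (tgt P a) => v; move e2: (src P a) => w h.
  case: h e1 e2 => [u e1 e2|a' w' ha' h e1 e2].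
    by exists a; rewrite e1 e2; split=> //; apply: reach_refl.
  exists a'; split=> //; apply: reach_trans h _; rewrite -e2 -e1.
  by apply: reach_step => //; apply: reach_refl.
have [walk [w0 w1 w2]] := IH a' ha' hr'.
exists (fun t => if t is t'.+1 then walk t' else a); split=> // -[|t] //.
- exact: w1.
- by rewrite w0.
- exact: w2.
Qed.

End Cycles.

(** * Ungluing a gentle presentation *)

Section Ungluing.
Variables (K : fieldType) (P0 : pres K).
Hypothesis gP : gentle_pres P0.
Local Open Scope nat_scope.

Local Notation n := (nv P0).

Let wfP : wf_pres P0. Proof. by case: gP. Qed.
Let src_lt a : a < narr P0 -> src P0 a < n. Proof. by case: wfP => h _ /h[]. Qed.
Let tgt_lt a : a < narr P0 -> tgt P0 a < n. Proof. by case: wfP => h _ /h[]. Qed.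

Definition bad v := has (fun a => has (fun b =>
  [&& src P0 a == v, tgt P0 b == v & inR P0 a b]) (arrows P0)) (arrows P0).

Lemma badP v : reflect (exists a b, [/\ a < narr P0, b < narr P0, src P0 a = v,
   tgt P0 b = v & inR P0 a b]) (bad v).
Proof.
apply: (iffP hasP) => [[a ha /hasP[b hb /and3P[/eqP h1 /eqP h2 h3]]]|].
  by exists a, b; rewrite -!mem_arrows.
move=> [a [b [ha hb h1 h2 h3]]]; exists a; rewrite ?mem_arrows //.
by apply/hasP; exists b; rewrite ?mem_arrows // h1 h2 !eqxx.
Qed.

Definition bads := [seq v <- iota 0 n | bad v].

Lemma mem_bads v : (v \in bads) = bad v && (v < n).
Proof. by rewrite mem_filter mem_iota. Qed.

Lemma bads_uniq : uniq bads. Proof. by rewrite filter_uniq // iota_uniq. Qed.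

(** Reference arrows at [v]. The default 0 is harmless: a vertex satisfying [bad] has arrows of both
    kinds. *)
Definition fst_out v := head 0 [seq a <- arrows P0 | src P0 a == v].
Definition fst_in v := head 0 [seq a <- arrows P0 | tgt P0 a == v].

Lemma head_filter (p : pred nat) s a : a \in s -> p a ->
  p (head 0 (filter p s)) /\ head 0 (filter p s) \in s.
Proof.
move=> h1 h2; have : a \in filter p s by rewrite mem_filter h2.
have : {in filter p s, forall x, p x /\ x \in s} by move=> x; rewrite mem_filter => /andP.
by case: (filter p s) => //= x t h _; apply: h; rewrite mem_head.
Qed.

Lemma fst_outP a : a < narr P0 ->
  src P0 (fst_out (src P0 a)) = src P0 a /\ fst_out (src P0 a) < narr P0.
Proof.
rewrite -mem_arrows => ha.
have [/eqP] := @head_filter (fun b => src P0 b == src P0 a) _ a ha (eqxx _).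
by rewrite mem_arrows.
Qed.

Lemma fst_inP a : a < narr P0 ->
  tgt P0 (fst_in (tgt P0 a)) = tgt P0 a /\ fst_in (tgt P0 a) < narr P0.
Proof.
rewrite -mem_arrows => ha.
have [/eqP] := @head_filter (fun b => tgt P0 b == tgt P0 a) _ a ha (eqxx _).
by rewrite mem_arrows.
Qed.

(* The two halves of a split vertex: an outgoing arrow lies in the same half as
   the reference incoming arrow iff their product is not a relation, and an
   incoming arrow is compared with the latter through the reference outgoing
   arrow. *)
Definition half_out a := bad (src P0 a) && inR P0 a (fst_in (src P0 a)).
Definition half_in b := let v := tgt P0 b in
  bad v && (inR P0 (fst_out v) (fst_in v) (+) inR P0 (fst_out v) b).

(** At a vertex without relations all terms vanish. At a bad vertex the gentle axiom says that
    exchanging the outgoing arrow flips membership for every incoming arrow, so [inR] is a sum of a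
    term in [a] and a term in [b], normalized at the reference arrows. *)
Lemma inR_half a b : a < narr P0 -> b < narr P0 -> src P0 a = tgt P0 b ->
  inR P0 a b = half_out a (+) half_in b.
Proof.
move=> ha hb e; rewrite /half_out /half_in -e.
have [hbad|nb] := boolP (bad (src P0 a)); last first.
  apply: contraNF nb => h; apply/badP; exists a, b; by split.
have [e1 h1] := fst_outP ha; have [] := fst_inP hb; rewrite -e.
move: (fst_out _) (fst_in _) e1 h1 => a0 b0 e1 h1 e2 h2 /=.
have [_ [_ [_ [go _]]]] := gP.
have [->|na] := eqVneq a a0; first by rewrite addbA addbb.
have [->|nb] := eqVneq b b0; first by rewrite addbb addbF.
have := go _ _ b0 ha h1 h2 na (esym e1) e2.
have := go _ _ b ha h1 hb na (esym e1) (esym e).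
by do 4!case: (inR _ _ _).
Qed.

(** Exactly one of two different outgoing arrows forms a relation with the reference incoming arrow,
    so they lie in different halves. *)
Lemma half_out_inj a1 a2 : a1 < narr P0 -> a2 < narr P0 -> src P0 a1 = src P0 a2 ->
  half_out a1 = half_out a2 -> bad (src P0 a1) -> a1 = a2.
Proof.
move=> h1 h2 e; rewrite /half_out -e => eh hb; rewrite hb /= in eh.
have /badP[a [b [_ hb' _ eb _]]] := hb.
have [] := fst_inP hb'; rewrite eb => e3 h3.
have [_ [_ [_ [go _]]]] := gP.
by apply/eqP/negPn/negP => n12; have := go _ _ _ h1 h2 h3 n12 e e3; rewrite eh addbb.
Qed.

Lemma half_in_inj b1 b2 : b1 < narr P0 -> b2 < narr P0 -> tgt P0 b1 = tgt P0 b2 ->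
  half_in b1 = half_in b2 -> bad (tgt P0 b1) -> b1 = b2.
Proof.
move=> h1 h2 e; rewrite /half_in -e => eh hb; rewrite hb /= in eh.
have /badP[a [b [ha _ ea _ _]]] := hb.
have [] := fst_outP ha; rewrite ea => e3 h3.
have [_ [_ [_ [_ gi]]]] := gP.
apply/eqP/negPn/negP => n12; have := gi _ _ _ h1 h2 h3 n12 e e3.
by move: eh; do 3!case: (inR _ _ _).
Qed.

(** The half marked [false] keeps its old number, so unsplit vertices are not renumbered; the fresh
    numbers follow the order of [bads]. *)
Definition splitv v (c : bool) := if c then n + index v bads else v.

Lemma splitv_inj v w (c d : bool) : v < n -> w < n -> (c -> v \in bads) -> (d -> w \in bads) ->
  splitv v c = splitv w d -> v = w /\ c = d.
Proof.
rewrite /splitv; case: c => hv hw; case: d => hc hd //; try by lia.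
by move/eqP; rewrite eqn_add2l => /eqP e; rewrite -(nth_index 0 (hc erefl)) e nth_index ?hd.
Qed.

Definition unglue : pres K := Pres (n + size bads)
  [seq (splitv (src P0 a) (half_out a), splitv (tgt P0 a) (half_in a)) | a <- arrows P0] [::].

Lemma narr_unglue : narr unglue = narr P0.
Proof. by rewrite /narr /= size_map size_iota. Qed.

Lemma src_unglue a : a < narr P0 -> src unglue a = splitv (src P0 a) (half_out a).
Proof. by move=> ha; rewrite /src /= (nth_map 0) ?size_iota // nth_iota. Qed.

Lemma tgt_unglue a : a < narr P0 -> tgt unglue a = splitv (tgt P0 a) (half_in a).
Proof. by move=> ha; rewrite /tgt /= (nth_map 0) ?size_iota // nth_iota. Qed.

Lemma half_out_bads a : a < narr P0 -> half_out a -> src P0 a \in bads.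
Proof. by move=> ha /andP[h _]; rewrite mem_bads h src_lt. Qed.

Lemma half_in_bads a : a < narr P0 -> half_in a -> tgt P0 a \in bads.
Proof. by move=> ha /andP[h _]; rewrite mem_bads h tgt_lt. Qed.

Lemma splitv_lt v (c : bool) : v < n -> (c -> v \in bads) -> splitv v c < n + size bads.
Proof.
rewrite /splitv; case: c => hv h; last by rewrite ltn_addr.
by rewrite ltn_add2l index_mem h.
Qed.

Lemma unglue_wf : wf_pres unglue.
Proof.
split=> // a; rewrite narr_unglue => ha; rewrite src_unglue // tgt_unglue //.
split; apply: splitv_lt; rewrite ?src_lt ?tgt_lt //.
  exact: half_out_bads.
exact: half_in_bads.
Qed.

(** Composable arrows of the unglued quiver meet in the same half of the same vertex, where
    [inR_half] excludes a relation. *)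
Lemma unglue_composable a b : a < narr P0 -> b < narr P0 -> tgt unglue b = src unglue a ->
  tgt P0 b = src P0 a /\ ~~ inR P0 a b.
Proof.
move=> ha hb; rewrite src_unglue // tgt_unglue // => /splitv_inj[||||e eh].
- exact: tgt_lt.
- exact: src_lt.
- exact: half_in_bads.
- exact: half_out_bads.
by split=> //; rewrite inR_half // eh addbb.
Qed.

Lemma outdeg_unglue_split v c : v \in bads -> outdeg unglue (splitv v c) <= 1.
Proof.
move=> hv; have [hbad vn] : bad v /\ v < n by move: hv; rewrite mem_bads => /andP.
apply: count_le1; first exact: iota_uniq.
move=> x y; rewrite !mem_arrows narr_unglue => hx hy.
rewrite !src_unglue // => /eqP/splitv_inj[||||ex cx] //; rewrite ?src_lt //.
  exact: half_out_bads.
move=> /eqP/splitv_inj[||||ey cy] //; rewrite ?src_lt //; first exact: half_out_bads.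
by apply: half_out_inj; rewrite ?ex ?ey ?cx ?cy.
Qed.

Lemma indeg_unglue_split v c : v \in bads -> indeg unglue (splitv v c) <= 1.
Proof.
move=> hv; have [hbad vn] : bad v /\ v < n by move: hv; rewrite mem_bads => /andP.
apply: count_le1; first exact: iota_uniq.
move=> x y; rewrite !mem_arrows narr_unglue => hx hy.
rewrite !tgt_unglue // => /eqP/splitv_inj[||||ex cx] //; rewrite ?tgt_lt //.
  exact: half_in_bads.
move=> /eqP/splitv_inj[||||ey cy] //; rewrite ?tgt_lt //; first exact: half_in_bads.
by apply: half_in_inj; rewrite ?ex ?ey ?cx ?cy.
Qed.

Definition split_vertices :=
  [seq splitv v false | v <- bads] ++ [seq splitv v true | v <- bads].

Lemma mem_split_vertices w :
  reflect (exists v c, v \in bads /\ w = splitv v c) (w \in split_vertices).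
Proof.
rewrite mem_cat; apply: (iffP orP) => [[]/mapP[v hv ->]|[v [[] [hv ->]]]].
- by exists v, false.
- by exists v, true.
- by right; apply: map_f.
- by left; apply: map_f.
Qed.

Lemma outdeg_unsplit w : w \notin split_vertices -> outdeg unglue w <= outdeg P0 w.
Proof.
move=> hw; rewrite /outdeg {1}/arrows narr_unglue; apply: leq_in_count => a.
rewrite mem_iota /= => ha; rewrite src_unglue // => /eqP e; apply/eqP.
have [nb|hb] := boolP (src P0 a \in bads).
  by case/mem_split_vertices: hw; exists (src P0 a), (half_out a).
by move: e; rewrite /splitv; case: ifP => // /(half_out_bads ha) h; rewrite h in hb.
Qed.

Lemma indeg_unsplit w : w \notin split_vertices -> indeg unglue w <= indeg P0 w.
Proof.
move=> hw; rewrite /indeg {1}/arrows narr_unglue; apply: leq_in_count => a.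
rewrite mem_iota /= => ha; rewrite tgt_unglue // => /eqP e; apply/eqP.
have [nb|hb] := boolP (tgt P0 a \in bads).
  by case/mem_split_vertices: hw; exists (tgt P0 a), (half_in a).
by move: e; rewrite /splitv; case: ifP => // /(half_in_bads ha) h; rewrite h in hb.
Qed.

(** If arrows both enter and leave [v], a second arrow on either side would force a relation at [v],
    so there is one of each. Otherwise only one kind of arrow occurs, at most twice. *)
Lemma not_bad_deg v : ~~ bad v -> outdeg P0 v + indeg P0 v <= 2.
Proof.
move=> nb; have [_ [d [_ [go gi]]]] := gP; have [d1 d2] := d v.
have [/outdegP[a ha ea]|] := boolP (0 < outdeg P0 v); last by lia.
have [/indegP[b hb eb]|] := boolP (0 < indeg P0 v); last by lia.
have nR x y : x < narr P0 -> y < narr P0 -> src P0 x = v -> tgt P0 y = v -> inR P0 x y = false.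
  by move=> hx hy ex ey; apply: contraNF nb => h; apply/badP; exists x, y.
have o1 : outdeg P0 v <= 1.
  apply: count_le1; first exact: iota_uniq.
  move=> x y; rewrite !mem_arrows => hx hy /eqP ex /eqP ey.
  apply/eqP/negPn/negP => nxy; have := go x y b hx hy hb nxy.
  by rewrite ex ey eb !nR // => /(_ erefl erefl).
have i1 : indeg P0 v <= 1.
  apply: count_le1; first exact: iota_uniq.
  move=> x y; rewrite !mem_arrows => hx hy /eqP ex /eqP ey.
  apply/eqP/negPn/negP => nxy; have := gi x y a hx hy ha nxy.
  by rewrite ex ey ea !nR // => /(_ erefl erefl).
by lia.
Qed.

Lemma unglue_deg w : outdeg unglue w + indeg unglue w <= 2.
Proof.
have [/mem_split_vertices[v [c [hv ->]]]|hw] := boolP (w \in split_vertices).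
  by have := outdeg_unglue_split c hv; have := indeg_unglue_split c hv; lia.
apply: leq_trans (leq_add (outdeg_unsplit hw) (indeg_unsplit hw)) _.
have [hb|nb] := boolP (bad w); last exact: not_bad_deg.
have /badP[a [b [ha _ ea _ _]]] := hb.
case/mem_split_vertices: hw; exists w, false.
by rewrite mem_bads hb -ea src_lt.
Qed.

Definition unglue_pairs := [seq (nth 0 bads k, n + k) | k <- iota 0 (size bads)].

Lemma unglue_pairsP p : reflect (exists2 v, v \in bads & p = (splitv v false, splitv v true))
  (p \in unglue_pairs).
Proof.
apply: (iffP mapP) => [[k]|[v hv ->]].
  rewrite mem_iota /= add0n => hk ->; exists (nth 0 bads k); first exact: mem_nth.
  by rewrite /splitv index_uniq // bads_uniq.
by exists (index v bads); rewrite ?nth_index // mem_iota index_mem.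
Qed.

Lemma glued_splitv v w (c d : bool) :
  v < n -> w < n -> (c -> v \in bads) -> (d -> w \in bads) ->
  glued unglue_pairs (splitv v c) (splitv w d) = (v == w) && (c (+) d).
Proof.
move=> hv hw hc hd; apply/idP/idP.
  case/orP=> /unglue_pairsP[u hu]; have := hu; rewrite mem_bads => /andP[_ un].
    move=> /eqP; rewrite xpair_eqE => /andP[] /eqP/splitv_inj[]// -> ->.
    by move=> /eqP/splitv_inj[]// -> ->; rewrite eqxx.
  move=> /eqP; rewrite xpair_eqE => /andP[] /eqP/splitv_inj[]// -> ->.
  by move=> /eqP/splitv_inj[]// -> ->; rewrite eqxx.
move=> /andP[/eqP e]; subst w; case: c d hc hd => -[] // hc hd _.
  by rewrite /glued; apply/orP; right; apply/unglue_pairsP; exists v => //; apply: hc.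
by rewrite /glued; apply/orP; left; apply/unglue_pairsP; exists v => //; apply: hd.
Qed.

Lemma gl_vertices_perm gl : perm_eq (gl_vertices gl) (map fst gl ++ map snd gl).
Proof.
elim: gl => //= -[i j] gl IH; rewrite perm_cons perm_sym -[j :: map _ _]cat1s perm_catCA /=.
by rewrite perm_cons perm_sym.
Qed.

Lemma unglue_pairs_vertices : perm_eq (gl_vertices unglue_pairs) split_vertices.
Proof.
apply: perm_trans (gl_vertices_perm _) _; rewrite -!map_comp.
rewrite -[X in perm_eq (X ++ _)]/(mkseq _ _) mkseq_nth /split_vertices map_id perm_cat2l.
rewrite (_ : map _ (iota _ _) = [seq splitv v true | v <- bads]) //.
rewrite -[in RHS](mkseq_nth 0 bads) -map_comp; apply/eq_in_map => k.
by rewrite mem_iota /= => hk; rewrite /splitv index_uniq // bads_uniq.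
Qed.

Lemma split_vertices_uniq : uniq split_vertices.
Proof.
rewrite cat_uniq map_id bads_uniq /=; apply/andP; split.
  apply/hasPn => w /mapP[v hv ->]; rewrite mem_bads; apply/negP => /andP[_].
  by rewrite /splitv; lia.
rewrite map_inj_in_uniq ?bads_uniq // => u v hu hv e.
have [] := @splitv_inj u v true true _ _ (fun=> hu) (fun=> hv) e => //.
  by move: hu; rewrite mem_bads => /andP[].
by move: hv; rewrite mem_bads => /andP[].
Qed.

Lemma split_vertices_lt w : w \in split_vertices -> w < n + size bads.
Proof.
case/mem_split_vertices=> v [c [hv ->]]; apply: splitv_lt => //.
by move: hv; rewrite mem_bads => /andP[].
Qed.

(* The renaming reached after the first m gluings. *)
Definition ren m v :=
  if v < n then v else if v - n < m then nth 0 bads (v - n) else v - m.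

(** Every gluing removes the smallest remaining fresh number and lowers the later ones, so the
    second vertex of the next pair is numbered [n] when its turn comes. *)
Lemma glue_all_ren (P : pres K) m l r : r =1 ren m -> m + l <= size bads ->
  (glue_all P [seq (nth 0 bads k, n + k) | k <- iota m l] r).2 =1 ren (m + l).
Proof.
elim: l m P r => [|l IH] m P r er hl; first by rewrite addn0.
rewrite /= -addSnnS; apply: IH; last by rewrite addSnnS.
have hnth k : k < size bads -> nth 0 bads k < n.
  by move=> hk; have := mem_nth 0 hk; rewrite mem_bads => /andP[].
have hm := hnth m ltac:(lia).
have -> : r (nth 0 bads m) = nth 0 bads m by rewrite er /ren hm.
have -> : r (n + m) = n by rewrite er /ren ltnNge leq_addr /= addKn ltnn; lia.
move=> v /=; rewrite er /ren /gren; case: (ltnP v n) => hv.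
  by rewrite ltn_eqF //; case: ifP; lia.
case: (ltnP (v - n) m) => h1.
  have h2 := hnth (v - n) ltac:(lia).
  by rewrite ltn_eqF //= ltnNge ltnW //= ltnS ltnW.
have [h2|h2] := eqVneq (v - n) m.
  have -> : v - m == n by lia.
  by rewrite h2 ltnSn ltnNge ltnW.
have -> : (v - m == n) = false by lia.
have -> : (v - n < m.+1) = false by lia.
have -> : n < v - m by lia.
by lia.
Qed.

Lemma unglue_pairs_ren v : (glue_all unglue unglue_pairs id).2 v = ren (size bads) v.
Proof. by rewrite (@glue_all_ren _ 0) // => u; rewrite /ren ltn0 subn0; case: ifP. Qed.

Lemma ren_splitv v (c : bool) : v < n -> (c -> v \in bads) -> ren (size bads) (splitv v c) = v.
Proof.
rewrite /ren /splitv; case: c => hv hc; last by rewrite hv.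
by rewrite ltnNge leq_addr /= addKn index_mem hc // nth_index // hc.
Qed.

(** By [inR_half] the gluings create relations exactly between composable arrows in different
    halves, which are the composable relations of [P0]; whatever else [P0] lists is
    non-composable. *)
Lemma reglue : rels_implied (glue_all unglue unglue_pairs id).1 P0 /\
  rels_implied P0 (glue_all unglue unglue_pairs id).1.
Proof.
have st : glue_state unglue unglue_pairs (glue_all unglue unglue_pairs id).1
    (glue_all unglue unglue_pairs id).2.
  apply: glue_all_state => //; first exact: unglue_wf.
    by rewrite (perm_uniq unglue_pairs_vertices) split_vertices_uniq.
  apply/allP => v; rewrite (perm_mem unglue_pairs_vertices); exact: split_vertices_lt.
have rE := unglue_pairs_ren; move: st rE.
case: (glue_all unglue unglue_pairs id) => Q r /= st rE.
have eN : nv Q = n.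
  by have := glue_nv st; rewrite size_map size_iota /=; lia.
have eA : arrs Q = arrs P0.
  rewrite (glue_arrs st) /= -map_comp -[RHS](mkseq_nth (0, 0)).
  apply/eq_in_map => a; rewrite mem_arrows /= => ha; rewrite !rE !ren_splitv.
  - by rewrite /src /tgt; case: (nth _ _ _).
  - exact: tgt_lt.
  - exact: half_in_bads.
  - exact: src_lt.
  - exact: half_out_bads.
have nU := narr_unglue.
have gE a b : a < narr P0 -> b < narr P0 ->
    glued unglue_pairs (src unglue a) (tgt unglue b) =
    (src P0 a == tgt P0 b) && (half_out a (+) half_in b).
  move=> ha hb; rewrite src_unglue // tgt_unglue //; apply: glued_splitv.
  - exact: src_lt.
  - exact: tgt_lt.
  - exact: half_out_bads.
  - exact: half_in_bads.
split; split=> // rho.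
  move=> /(glue_rels st)[a [b []]]; rewrite nU => ha hb ->; rewrite gE //.
  by move=> /andP[/eqP e h]; left; rewrite -/(inR P0 a b) inR_half.
move=> hr; have [_ [_ [hz _]]] := gP; have [a [b e]] := hz rho hr; subst rho.
have [_ wf2] := wfP.
have ha : a < narr P0 by apply: (wf2 _ _ _ hr (mem_head _ _)); rewrite mem_head.
have hb : b < narr P0.
  by apply: (wf2 _ _ _ hr (mem_head _ _)); rewrite !inE eqxx orbT.
have [e|ne] := eqVneq (src P0 a) (tgt P0 b).
  left; apply/(glue_rels st); exists a, b; rewrite nU gE // e eqxx -inR_half //.
right; exists a, b; rewrite /src /tgt /narr eA; split=> //.
exact/eqP.
Qed.

Variables (bl : seq nat) (A : falgType K).
Hypotheses (ubl : uniq bl) (sbl : forall i, i \in bl -> sg_vertex P0 i).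
Hypothesis pA : presents A (blow_all P0 bl).

(** By [unglue_composable] a walk around an oriented cycle meets no relation of [P0], while
    [walk_dim] bounds the length of such walks by the dimension of [A]. *)
Lemma unglue_acyclic : acyclic unglue.
Proof.
move=> a ha hr.
(* The dimension itself is already too large a length, as the bound is strict. *)
have [walk [_ w1 w2]] := cycle_walk (\dim {: A}) ha hr.
rewrite narr_unglue in w1.
have [_ [_ [hz _]]] := gP.
have [|o cov] := cover_blow_all ubl _ (cover_id wfP hz).
  by move=> i /sbl[hi [_ [_ [nl _]]]].
have wc t : t < \dim {: A} -> tgt P0 (walk t) = src P0 (walk t.+1) /\
    ~~ inR P0 (walk t.+1) (walk t).
  by move=> ht; apply: unglue_composable (w2 t ht); apply: w1 => //; apply: ltnW.
have := walk_dim cov w1 (fun t ht => proj1 (wc t ht)) (fun t ht => proj2 (wc t ht)) pA.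
by rewrite ltnn.
Qed.

Lemma gentle_unglue : exists P gl, hereditary_pres P /\ typeA_Atilde P /\ suitable P gl bl /\
  (forall v, v \in seq_vertices gl bl -> outdeg P v <= 1 /\ indeg P v <= 1) /\
  presents A (apply_seq P gl bl).
Proof.
have ac := unglue_acyclic.
(* A vertex that may be blown up carries no relation, so it is not split. *)
have nsplit v : v \in bl -> v \notin split_vertices.
  case/sbl=> hv [_ [_ [_ nR]]]; apply/mem_split_vertices=> -[w [c [hw]]].
  have := hw; rewrite mem_bads => /andP[hbad hwn] e.
  have [//|//|ew _] := @splitv_inj v w false c hv hwn _ _ e.
  subst w; have /badP[a [b [ha hb ea eb hab]]] := hbad.
  by have := nR a b ha hb ea eb; rewrite hab.
have pv := unglue_pairs_vertices.
have bl_lt v : v \in bl -> v < n by case/sbl.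
exists unglue, unglue_pairs; split; first by split; [exact: unglue_wf | ].
split.
  apply: typeA_of_deg; [exact: unglue_wf | | exact: unglue_deg].
  by move=> a ha e; apply: (ac a ha); rewrite e; apply: reach_refl.
split.
  split.
    rewrite /seq_vertices -/(gl_vertices _) cat_uniq (perm_uniq pv) split_vertices_uniq ubl andbT.
    by apply/hasPn => v /nsplit; rewrite (perm_mem pv).
  rewrite all_cat; apply/andP; split; apply/allP => v.
    by rewrite -/(gl_vertices _) (perm_mem pv) => /split_vertices_lt.
  by move/bl_lt => h; rewrite ltn_addr.
split.
  move=> v; rewrite mem_cat -/(gl_vertices _) (perm_mem pv) => /orP[|vb].
    case/mem_split_vertices=> w [c [hw ->]].
    by split; [exact: outdeg_unglue_split | exact: indeg_unglue_split].
  have [_ [o1 [i1 _]]] := sbl vb; have hv := nsplit v vb.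
  by split; [apply: leq_trans o1; exact: outdeg_unsplit
            |apply: leq_trans i1; exact: indeg_unsplit].
have [r1 r2] := reglue.
have rE := unglue_pairs_ren; rewrite /apply_seq; move: r1 r2 rE.
case: (glue_all unglue unglue_pairs id) => Q r /= r1 r2 rE.
(* The renaming moves only fresh vertices, whereas those in [bl] are old. *)
have -> : map r bl = bl.
  by rewrite map_id_in // => v /bl_lt hv; rewrite rE /ren hv.
have wP : wf_arrows P0 by case: wfP.
have wQ : wf_arrows Q.
  by move=> a; have [e1 e2 _] := r1; rewrite e1 /narr /src /tgt e2; apply: wP.
apply: presents_equiv pA; try exact: wf_arrows_blow_all; exact: rels_implied_blow_all.
Qed.

End Ungluing.

(** * Characterization of skewed-gentle and gentle nodal algebras *)

Theorem theorem3p1 (K : closedFieldType) (A : falgType K) :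
  nodal_basic A -> ~ hereditary_alg A ->
  (skewed_gentle_alg A <->
     exists (P : pres K) gl bl,
       hereditary_pres P /\ typeA_Atilde P /\ suitable P gl bl /\
       (forall v, v \in seq_vertices gl bl -> (outdeg P v <= 1)%N /\ (indeg P v <= 1)%N) /\
       presents A (apply_seq P gl bl)) /\
  (gentle_alg A <->
     exists (P : pres K) gl,
       hereditary_pres P /\ typeA_Atilde P /\ suitable P gl [::] /\
       (forall v, v \in seq_vertices gl [::] -> (outdeg P v <= 1)%N /\ (indeg P v <= 1)%N) /\
       presents A (apply_seq P gl [::])).
Proof.
move=> _ _; split; split.
- move=> [P [bl [gP [ubl [sbl pA]]]]].
  by have [Q [gl h]] := gentle_unglue gP ubl sbl pA; exists Q, gl, bl.
- move=> [P [gl [bl [hP [tA [sP [dP pA]]]]]]].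
  have [Q [bl' [gQ ubl sbl e _]]] := skewed_gentle_of_typeA hP tA sP dP.
  by exists Q, bl'; rewrite -e.
(* A gentle algebra is treated as a skewed-gentle one with an empty list of blowings up. *)
- by move=> [P [gP pA]]; apply: (gentle_unglue (bl := [::]) gP).
- move=> [P [gl [hP [tA [sP [dP pA]]]]]].
  (* Equality of lengths shows that no vertex of the gentle presentation is blown up. *)
  have [Q [bl [gQ _ _ e /eqP/nilP bl0]]] := skewed_gentle_of_typeA hP tA sP dP.
  by exists Q; split=> //; rewrite e bl0 in pA.
Qed.
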